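(* Consider the online positive-influence maximization problem under the LT-N model with node-level feedback on a finite directed graph $G=(V,E)$ with edge features $x:E\to\mathbb{R}^d$, node features $x_+,x_-:V\to\mathbb{R}^{d'}$, seed budget $K$ and unknown parameters $\theta^*\in\mathbb{R}^d$, $\beta^*\in\mathbb{R}^{d'}$. Let $q$ be a positive integer, and suppose: (B1) $\|\theta^*\|\le D$, $w_{\theta^*}(e)=x(e)^\top\theta^*\in[0,1]$ for all $e\in E$, and $\sum_{u\in N^{in}(v)}w_{\theta^*}(u,v)\le1$ for all $v\in V$. (B2) $\|\sum_{u\in B}x(u,v)\|\le1$ for all $v\in V$ and all $B\subseteq N^{in}(v)$. (B3) There are $d$ edges $e_1^\circ,\dots,e_d^\circ$ with $\lambda_{\min}\big(\sum_{i=1}^d x(e_i^\circ)x(e_i^\circ)^\top\big)>0$. (B4) $\|\beta^*\|\le D_\beta$, and the true autonomy factors are $q^+(v)=x_+(v)^\top\beta^*\ge0$, $q^-(v)=x_-(v)^\top\beta^*\ge0$ with $q^+(v)+q^-(v)\le1$ for all $v\in V$. (B5) There are $d'$ nodes $v_1^{auto},\dots,v_{d'}^{auto}$, each with at least one parent (in-neighbor), such that $\lambda_{\min}\big(\sum_{i=1}^{d'}x_-(v_i^{auto})x_-(v_i^{auto})^\top\big)>0$. (B6) With $\alpha=1-1/e-\epsilon_0$ for some $\epsilon_0>0$, there is an efficient, possibly random, $(\alpha,\gamma)$-oracle: on input $(G,w,q^\pm,K)$ it outputs a seed set $\tilde S$ with $|\tilde S|\le K$ such that $f^+(\tilde S,w,q^\pm)\ge\alpha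 f^{\mathrm{opt}}(w,q^\pm)$ with probability at least $\gamma$. (B7) There are $\epsilon_\theta,\epsilon_\beta>0$ such that all $\theta\in\mathbb{R}^d,\beta\in\mathbb{R}^{d'}$ with $\|\theta-\theta^*\|\le\epsilon_\theta$ and $\|\beta-\beta^*\|\le\epsilon_\beta$ satisfy $\mathcal{A}(\theta,\beta,\alpha)=\mathcal{A}(\theta^*,\beta^*,\alpha)$; moreover there is a seed set $S^{\mathcal{A}}$ with $S^{\mathcal{A}}\in\arg\min\{f^+(S,w_\theta,q_\beta):S\in\mathcal{A}(\theta,\beta,\alpha)\}$ for all such $(\theta,\beta)$. Then the epoch-based explore/exploit algorithm for LT-N (Algorithm 2, described in the context) with hyperparameter $q$ has, as the number of rounds $T\to\infty$, expected average scaled regret $$\frac1T\sum_{t=1}^T\mathbb{E}[R_t^{\alpha\gamma}]\le O\big(T^{-q/(q+1)}\big),$$ i.e. there are constants $C$ and $T_0$, not depending on $T$, such that the left-hand side is at most $C\,T^{-q/(q+1)}$ for all $T\ge T_0$.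
   Context: $\|\cdot\|$ is the Euclidean norm; $N^{in}(v)=\{u:(u,v)\in E\}$; $w_\theta(e)=x(e)^\top\theta$; $q_\beta=(q_\beta^+,q_\beta^-)$ with $q_\beta^\pm(v)=x_\pm(v)^\top\beta$; for an edge $e=(u,v)$, $\mathrm{head}(e)=u$ (source) and $\mathrm{tail}(e)=v$ (target). LT-N diffusion with seed set $S$, weights $w:E\to[0,1]$ (with $\sum_{u\in N^{in}(v)}w(u,v)\le1$) and autonomy factors $q^\pm=(q^+,q^-)$ (nonnegative, $r(v):=q^+(v)+q^-(v)\le1$): at step $0$ the nodes of $S$ are active and positive, and each $v\in V\setminus S$ independently samples $b_v$ uniformly from $[0,1]$. Write $A_\tau$ (resp. $A_\tau^+$) for the set of nodes active (resp. positive) by the end of step $\tau$, with $A_{-1}=\emptyset$. In each step $\tau\ge1$, each inactive $v$ with $\sum_{u\in N^{in}(v)\cap A_{\tau-1}}w(u,v)\ge b_v$ becomes active; given this, independently across nodes, it becomes (permanently) positive with probability $$q^+(v)+[1-r(v)]\frac{\sum_{u\in N^{in}(v)\cap(A^+_{\tau-1}\setminus A_{\tau-2})}w(u,v)}{\sum_{u\in N^{in}(v)\cap(A_{\tau-1}\setminus A_{\tau-2})}w(u,v)}$$ and (permanently) negative otherwise. The process stops when no further node can be activated. $f^+(S,w,q^\pm)$ is the expected number of positive nodes at the end; for inadmissible $(w,q^\pm)$ it is extended by an arbitrary fixed convention. $f^{\mathrm{opt}}(w,q^\pm)=\max\{f^+(S,w,q^\pm):S\subseteq V,|S|\le K\}$;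 $\mathcal{A}(\theta,\beta,\alpha)=\{S\subseteq V:f^+(S,w_\theta,q_\beta)\ge\alpha f^{\mathrm{opt}}(w_\theta,q_\beta)\}$. Online problem: in rounds $t=1,2,\dots$ the agent picks a seed set $S_t$ based on past observations; an independent LT-N diffusion with true weights $w_{\theta^*}$ and autonomy factors $q_{\beta^*}$ is run from $S_t$, and the agent observes at which step each node becomes active and its sign. Scaled regret: $R_t^{\eta}=f^{\mathrm{opt}}(w_{\theta^*},q_{\beta^*})-\frac1\eta f^+(S_t,w_{\theta^*},q_{\beta^*})$; expectations are over all randomness, including the oracle's, whose internal randomness is fresh in every call. Algorithm 2. For each $i\le d'$ fix a set $N(v_i^{auto})$ of $\min\{|N^{in}(v_i^{auto})|,K\}$ parents of $v_i^{auto}$ (those of smallest index). Epoch $k$ starts at round $t_k=1+\sum_{m=1}^{k-1}(d+d'+m^q)$ and consists of $d$ edge-exploration rounds, $d'$ autonomy-exploration rounds, and $k^q$ exploitation rounds, in this order. In the $i$-th edge-exploration round ($t=t_k+i-1$), $S_t=\{\mathrm{head}(e_i^\circ)\}$ and one records $\bar x_t=x(e_i^\circ)$, $y_t=\mathbf{1}\{\mathrm{tail}(e_i^\circ)\text{ is activated at step }1\}$. Then $\theta_k=M_k^{-1}r_k$ with $M_k=I+\sum\bar x_t\bar x_t^\top$, $r_k=\sum y_t\bar x_t$, summed over all edge-exploration rounds of epochs $1,\dots,k$. In the $i$-th autonomy-exploration round ($t=t_k+d+i-1$), $S_t=N(v_i^{auto})$; if $v_i^{auto}$ is activated at step $1$,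 the pair $x_-(v_i^{auto})$ and $1-y_t^+$ is recorded, where $y_t^+=\mathbf{1}\{v_i^{auto}\text{ is positively activated in round }t\}$. Then $\beta_k=V_k^{-1}s_k$ with $V_k=I+\sum x_-(v_i^{auto})x_-(v_i^{auto})^\top$ and $s_k=\sum(1-y_t^+)x_-(v_i^{auto})$, summed over all recorded pairs in epochs $1,\dots,k$. In every exploitation round of epoch $k$, $S_t$ is the output of the oracle on $(G,w_{\theta_k},q_{\beta_k},K)$.
   Formalization: (B5) is strengthened: the chosen parents N(v_i^auto) must have positive total true weight into v_i^auto (with zero weight nothing is recorded and regret can be linear); G has no self-loops, and α>0, 0<γ≤1 are made explicit. *)

(* Defs.v *)
From HB Require Import structures.
From mathcomp Require Import all_boot all_order all_algebra.
From mathcomp Require Import all_classical all_reals all_analysis.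

Set Implicit Arguments.
Unset Strict Implicit.
Unset Printing Implicit Defensive.

Import Order.TTheory GRing.Theory Num.Theory.
Local Open Scope ring_scope.

Section Euclidean.
Context {R : realType}.

(* The norm that MathComp-Analysis puts on matrices is the sup norm. *)
Definition enorm n (a : 'cV[R]_n) : R := Num.sqrt (\sum_(i < n) a i 0 ^+ 2).

Definition dot n (a b : 'cV[R]_n) : R := (a^T *m b) 0 0.

(* Only used for symmetric matrices, whose eigenvalues are all real.  For n = 0
   the spectrum is empty and the value is the default 0 of inf. *)
Definition lambda_min n (M : 'M[R]_n) : R := inf [set a | eigenvalue M a]%classic.

Definition is_pmf (T : finType) (p : T -> R) : Prop :=
  (forall a, 0 <= p a) /\ \sum_a p a = 1.

Definition point_mass (T : finType) (a : T) : T -> R := fun b => (b == a)%:R.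

End Euclidean.

Section Graph.
Context {R : realType} {V : finType}.
Variable E : {set V * V}.

Definition loopless : Prop := forall v, (v, v) \notin E.

Definition in_nbrs (v : V) : {set V} := [set u | (u, v) \in E].

(* Weights are functions on all pairs, but only the values on E are used. *)
Definition in_weight (w : V * V -> R) (A : {set V}) (v : V) : R :=
  \sum_(u in in_nbrs v :&: A) w (u, v).

Definition admissible_weights (w : V * V -> R) : bool :=
  [forall e in E, 0 <= w e <= 1] && [forall v, in_weight w [set: V] v <= 1].

Definition admissible_autonomy (qp qm : V -> R) : bool :=
  [forall v, [&& 0 <= qp v, 0 <= qm v & qp v + qm v <= 1]].

(* Set of nodes active by the end of step tau, for given thresholds b: it does
   not depend on the signs, and is constant from step #|V| on. *)
Fixpoint active (w : V * V -> R) (S : {set V}) (b : V -> R) (tau : nat)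
    : {set V} :=
  if tau is tau'.+1 then
    let A := active w S b tau' in A :|: [set v | b v <= in_weight w A v]
  else S.

(* Expectation of F b over independent uniform thresholds b v on [0, 1], v in s
   (the other thresholds being those of b), as an iterated integral. *)
Fixpoint threshold_integral (s : seq V) (F : (V -> R) -> R) (b : V -> R) : R :=
  if s is v :: s' then
    \int[uniform_prob (@ltr01 R)]_y
      threshold_integral s' F (fun u => if u == v then y else b u)
  else F b.

Definition threshold_mean (F : (V -> R) -> R) : R :=
  threshold_integral (enum V) F (fun _ => 0).

(* The complete record of a diffusion, i.e. the node-level feedback: for each
   node, the step at which it is activated (if ever) and its sign (true =
   positive). *)
Definition outcome : finType := {ffun V -> option ('I_#|V|.+1 * bool)}.

Definition act_step (o : outcome) (v : V) : option nat :=
  omap (fun p => nat_of_ord p.1) (o v).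

Definition positive (o : outcome) (v : V) : bool :=
  if o v is Some p then p.2 else false.

Definition positives (o : outcome) : {set V} := [set v | positive o v].

Definition active_by (o : outcome) (tau : nat) : {set V} :=
  [set v | if act_step o v is Some m then (m <= tau)%N else false].

Definition active_at (o : outcome) (tau : nat) : {set V} :=
  [set v | act_step o v == Some tau].

(* Probability that v, activated at step tau >= 1, becomes positive, given the
   earlier steps.  The quotient is 0 / 0 = 0 only if v is activated with b v = 0
   by active parents of total weight 0, an event of probability 0. *)
Definition pos_prob (w : V * V -> R) (qp qm : V -> R) (o : outcome) (v : V)
    (tau : nat) : R :=
  qp v + (1 - (qp v + qm v)) *
    (in_weight w (active_at o tau.-1 :&: positives o) v
     / in_weight w (active_at o tau.-1) v).

(* Conditional probability, given the thresholds, of the signs in o. *)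
Definition sign_prob (w : V * V -> R) (qp qm : V -> R) (o : outcome) : R :=
  \prod_(v : V)
    match act_step o v with
    | None => 1
    | Some 0%N => (positive o v)%:R
    | Some tau => if positive o v then pos_prob w qp qm o v tau
                  else 1 - pos_prob w qp qm o v tau
    end.

Definition outcome_prob (w : V * V -> R) (qp qm : V -> R) (S : {set V})
    (o : outcome) : R :=
  threshold_mean (fun b =>
    [forall tau : 'I_#|V|.+1, active w S b tau == active_by o tau]%:R
      * sign_prob w qp qm o).

(* f^+; fext is the convention used for inadmissible arguments. *)
Definition fplus
    (fext : (V * V -> R) -> (V -> R) -> (V -> R) -> {set V} -> R)
    (w : V * V -> R) (qp qm : V -> R) (S : {set V}) : R :=
  if admissible_weights w && admissible_autonomy qp qm then
    \sum_(o : outcome) outcome_prob w qp qm S o * #|positives o|%:R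
  else fext w qp qm S.

Definition fopt fext (K : nat) (w : V * V -> R) (qp qm : V -> R) : R :=
  \big[Num.max/fplus fext w qp qm finset.set0]_(S : {set V} | (#|S| <= K)%N)
    fplus fext w qp qm S.

(* An oracle maps (w, q^+, q^-) to the law of the seed set it outputs. *)
Definition is_oracle fext (K : nat) (alpha gamma : R)
    (oracle : (V * V -> R) -> (V -> R) -> (V -> R) -> {set V} -> R) : Prop :=
  forall w qp qm,
    [/\ is_pmf (oracle w qp qm),
        forall S, oracle w qp qm S != 0 -> (#|S| <= K)%N
      & gamma <= \sum_(S : {set V} |
                   alpha * fopt fext K w qp qm <= fplus fext w qp qm S)
                   oracle w qp qm S].

Definition scaled_regret fext (K : nat) (w : V * V -> R) (qp qm : V -> R)
    (eta : R) (S : {set V}) : R :=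
  fopt fext K w qp qm - eta^-1 * fplus fext w qp qm S.

(* A (randomized) policy gives the law of the next seed set as a function of the
   list of the outcomes of the past rounds, in chronological order. *)
Definition policy := seq outcome -> {set V} -> R.

(* Expectation of F applied to the history of the first n rounds, in which
   round t draws S_t from the policy, then an LT-N outcome from S_t which,
   given S_t, is independent of the past. *)
Fixpoint history_mean (pi : policy) (w : V * V -> R) (qp qm : V -> R) (n : nat)
    (F : seq outcome -> R) : R :=
  if n is n'.+1 then
    history_mean pi w qp qm n' (fun h =>
      \sum_(S : {set V}) pi h S *
        \sum_(o : outcome) outcome_prob w qp qm S o * F (rcons h o))
  else F [::].

(* E[g(S_t)] for rounds t = 1, 2, ... *)
Definition seed_mean (pi : policy) (w : V * V -> R) (qp qm : V -> R)
    (t : nat) (g : {set V} -> R) : R :=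
  history_mean pi w qp qm t.-1 (fun h => \sum_(S : {set V}) pi h S * g S).

End Graph.

Section Linear.
Context {R : realType} {V : finType} {d d' : nat}.
Variables (E : {set V * V}) (x : V * V -> 'cV[R]_d) (xp xm : V -> 'cV[R]_d').

Definition edge_weight (theta : 'cV[R]_d) : V * V -> R := fun e => dot (x e) theta.

Definition auton (xv : V -> 'cV[R]_d') (beta : 'cV[R]_d') : V -> R :=
  fun v => dot (xv v) beta.

Definition f_lin fext (theta : 'cV[R]_d) (beta : 'cV[R]_d') : {set V} -> R :=
  fplus E fext (edge_weight theta) (auton xp beta) (auton xm beta).

Definition good_sets fext (K : nat) (alpha : R) (theta : 'cV[R]_d)
    (beta : 'cV[R]_d') : {set {set V}} :=
  [set S : {set V} |
     alpha * fopt E fext K (edge_weight theta) (auton xp beta) (auton xm beta)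
     <= f_lin fext theta beta S].

End Linear.

Section Schedule.
Variables d d' q : nat.

Definition epoch_start (k : nat) : nat :=
  (\sum_(1 <= m < k) (d + d' + m ^ q))%N.+1.

(* Epochs have at least one round, so the epoch of round t is at most t. *)
Definition epoch_of (t : nat) : nat :=
  (\max_(1 <= k < t.+1 | epoch_start k <= t) k)%N.

Inductive phase :=
  | EdgeExploration of 'I_d
  | AutonomyExploration of 'I_d'
  | Exploitation.

Definition phase_of (t : nat) : phase :=
  let j := (t - epoch_start (epoch_of t))%N in
  if insub j is Some i then EdgeExploration i
  else if insub (j - d)%N is Some i then AutonomyExploration i
  else Exploitation.

End Schedule.

Arguments Exploitation {d d'}.

Section Algorithm.
Context {R : realType} {V : finType} {d d' : nat}.
Variables (E : {set V * V}) (x : V * V -> 'cV[R]_d) (xp xm : V -> 'cV[R]_d').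
Variables (K q : nat) (edg : 'I_d -> V * V) (vauto : 'I_d' -> V).
Variable oracle : (V * V -> R) -> (V -> R) -> (V -> R) -> {set V} -> R.

(* The indexing of the nodes is the enumeration of V. *)
Definition chosen_parents (v : V) : {set V} :=
  [set u in take K (enum (in_nbrs E v))].

(* Outcome of round t >= 1; the default is irrelevant. *)
Definition round (h : seq (@outcome V)) (t : nat) : @outcome V :=
  nth [ffun=> None] h t.-1.

Definition edge_round (k : nat) (i : 'I_d) : nat :=
  (epoch_start d d' q k + i)%N.

Definition auton_round (k : nat) (i : 'I_d') : nat :=
  (epoch_start d d' q k + d + i)%N.

Definition edge_gram (k : nat) : 'M[R]_d :=
  1%:M + \sum_(1 <= m < k.+1) \sum_(i < d) x (edg i) *m (x (edg i))^T.

Definition edge_response (h : seq outcome) (k : nat) : 'cV[R]_d :=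
  \sum_(1 <= m < k.+1) \sum_(i < d)
    (act_step (round h (edge_round m i)) (edg i).2 == Some 1%N)%:R *: x (edg i).

Definition theta_hat (h : seq outcome) (k : nat) : 'cV[R]_d :=
  invmx (edge_gram k) *m edge_response h k.

Definition recorded (h : seq outcome) (k : nat) (i : 'I_d') : bool :=
  act_step (round h (auton_round k i)) (vauto i) == Some 1%N.

Definition auton_gram (h : seq outcome) (k : nat) : 'M[R]_d' :=
  1%:M + \sum_(1 <= m < k.+1) \sum_(i < d' | recorded h m i)
           xm (vauto i) *m (xm (vauto i))^T.

Definition auton_response (h : seq outcome) (k : nat) : 'cV[R]_d' :=
  \sum_(1 <= m < k.+1) \sum_(i < d' | recorded h m i)
    (1 - (positive (round h (auton_round m i)) (vauto i))%:R)
      *: xm (vauto i).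

Definition beta_hat (h : seq outcome) (k : nat) : 'cV[R]_d' :=
  invmx (auton_gram h k) *m auton_response h k.

Definition explore_exploit : @policy R V := fun h =>
  let t := (size h).+1 in
  match phase_of d d' q t with
  | EdgeExploration i => point_mass [set (edg i).1]
  | AutonomyExploration i => point_mass (chosen_parents (vauto i))
  | Exploitation =>
      let k := epoch_of d d' q t in
      oracle (edge_weight x (theta_hat h k))
             (auton xp (beta_hat h k)) (auton xm (beta_hat h k))
  end.

End Algorithm.

(* Main.v *)
(* Given that v is activated at step 1 by positive seeds, it is negative with
   probability q^-(v); it is so activated with the total weight of its seed
   parents.  The exploration rounds therefore feed two linear regressions with
   bounded martingale noise, and Hoeffding's argument (exponential moments, since
   the seed sets of these rounds are deterministic) shows that after k epochs
   both estimates are within a fixed distance of the truth outside an event of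
   probability O(exp(-c k)), hence O(k^-q).  By (B7) the oracle then returns,
   with probability gamma, a set that is good for the true parameters, so that
   the expected scaled regret of the k^q exploitation rounds of epoch k is O(1),
   like that of its exploration rounds.  The total regret is thus linear in the
   number of epochs, and T rounds contain O(T^(1/(q+1))) of them. *)
Require Import Defs.
From mathcomp Require Import all_boot all_order all_algebra.
From mathcomp Require Import all_classical all_reals all_analysis.
From mathcomp Require Import zify ring lra.

Set Implicit Arguments.
Unset Strict Implicit.
Unset Printing Implicit Defensive.

Import Order.TTheory GRing.Theory Num.Theory.
Local Open Scope ring_scope.

(** * Iterated threshold integrals *)

(** All samples taken at one exploration edge or node share their feature vector and their seed set,
    so the regressions see the noise only through one scalar sum per edge or node. Scalar tail
    bounds for these sums suffice, and the rest is a deterministic estimate for weighted ridge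
    regression. In the autonomy regression the weights are random, being the numbers of recorded
    samples. They need a concentration bound of their own, so each autonomy node contributes two
    statistics and each edge one. The means of these statistics must be extracted from an iterated
    integral of a product of sign probabilities. Thresholds enter only through finitely many
    comparisons, so the integrands are step functions and linearity is available. Given the
    thresholds, the factor of a node involves the signs of nodes activated one step earlier. Signs
    are therefore summed out from the last activation step backwards, where no remaining factor
    depends on the sign being removed. *)

Section Thresholds.
Context {R : realType} {V I : finType}.
Variable c : V -> I -> R.

Notation unif := (uniform_prob (@ltr01 R)).

(* The integrands below see a threshold only through its position relative to
   finitely many cut points, so that they are step functions of it. *)
Definition same_cell (v : V) (y z : R) := forall i, (y <= c v i) = (z <= c v i).

Definition cellwise (F : (V -> R) -> R) :=
  forall b b', (forall v, same_cell v (b v) (b' v)) -> F b = F b'.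

Lemma Rintegral_uniform_cst (a : R) : \int[unif]_y a = a.
Proof.
rewrite (Rintegral_cst _ measurableT) -[RHS]mulr1.
have h : unif [set: R]%classic = 1%E := probability_setT unif.
by rewrite -[X in fine X]/(unif [set: R]%classic) h.
Qed.

(** [g] factors through the pattern [k y] of comparisons with the cut points. There are finitely
    many patterns, and their fibres are finite intersections of half-lines, so [g] is measurable and
    bounded. *)
Lemma integrable_cellwise v (g : R -> R) :
  (forall y z, same_cell v y z -> g y = g z) ->
  unif.-integrable [set: R]%classic (EFin \o g).
Proof.
move=> hg.
pose k (y : R) : {ffun I -> bool} := [ffun i => y <= c v i].
(* The value on a cell is read at a chosen representative; patterns realized by no threshold get the
   default 0. *)
pose G (t : {ffun I -> bool}) : R :=
  if pselect (exists y, k y = t) is left h then g (projT1 (cid h)) else 0.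
have gE y : g y = G (k y).
  rewrite /G; case: pselect => [h|[]]; last by exists y.
  case: (cid h) => z /= hz; apply: hg => i.
  by move/ffunP: hz => /(_ i); rewrite !ffunE.
have mk t : measurable [set y : R | k y = t]%classic.
  have -> : [set y : R | k y = t]%classic =
      (\bigcap_(i in [set: I]) [set y : R | (y <= c v i) = t i])%classic.
    apply/seteqP; split=> y /= h.
      by move=> i _; rewrite -h ffunE.
    by apply/ffunP => i; rewrite ffunE; apply: h.
  apply: fin_bigcap_measurable; first exact: (@finite_finset I).
  move=> i _; case: (t i).
    have -> : [set y : R | (y <= c v i) = true]%classic = `]-oo, c v i]%classic.
      by apply/seteqP; split=> y /=; rewrite in_itv.
    exact: measurable_itv.
  have -> : [set y : R | (y <= c v i) = false]%classic = `]c v i, +oo[%classic.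
    apply/seteqP; split=> y /=; rewrite in_itv /= andbT.
      by rewrite real_ltNge ?num_real// => ->.
    by rewrite real_ltNge ?num_real// => /negbTE.
  exact: measurable_itv.
apply: measurable_bounded_integrable => //.
- by apply: (le_lt_trans (@probability_le1 _ _ _ unif _ measurableT)); rewrite ltry.
- move=> _ Y mY; rewrite setTI.
  have -> : (g @^-1` Y)%classic =
     (\bigcup_(t in [set t | Y (G t)]) [set y : R | k y = t])%classic.
    apply/seteqP; split=> y /=; first by rewrite gE => h; exists (k y).
    by case=> t /= Yt kt; rewrite gE kt.
  apply: fin_bigcup_measurable; first exact: (@finite_finset {ffun I -> bool}).
  by move=> t _; exact: mk.
- exists (\sum_t `|G t|); split; first exact: num_real.
  move=> M hM y _ /=; rewrite gE; apply: (le_trans _ (ltW hM)).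
  by rewrite (bigD1 (k y)) //= lerDl sumr_ge0.
Qed.

Definition upd (b : V -> R) v y : V -> R := fun u => if u == v then y else b u.

Lemma same_cell_upd b b' v y y' :
  (forall u, same_cell u (b u) (b' u)) -> same_cell v y y' ->
  forall u, same_cell u (upd b v y u) (upd b' v y' u).
Proof. by move=> hb hy u; rewrite /upd; case: eqP => [->|]. Qed.

Lemma cellwise_threshold_integral s F :
  cellwise F -> cellwise (threshold_integral s F).
Proof.
elim: s F => [//|v s IH] F hF b b' hb /=.
apply: eq_Rintegral => y _; apply: IH => // u.
exact: (@same_cell_upd b b' v y y).
Qed.

Lemma threshold_integral_integrable v s F b : cellwise F ->
  unif.-integrable [set: R]%classic
    (EFin \o (fun y => threshold_integral s F (upd b v y))).
Proof.
move=> hF; apply: (@integrable_cellwise v) => y z hyz.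
by apply: cellwise_threshold_integral => //; apply: same_cell_upd.
Qed.

Lemma threshold_integral_cst s a b :
  threshold_integral s (fun _ : V -> R => a) b = a.
Proof.
elim: s b => [//|v s IH] b /=.
under eq_Rintegral do rewrite IH.
by rewrite Rintegral_uniform_cst.
Qed.

Lemma threshold_integralD s F G b : cellwise F -> cellwise G ->
  threshold_integral s (fun b => F b + G b) b =
  threshold_integral s F b + threshold_integral s G b.
Proof.
move=> hF hG; elim: s b => [//|v s IH] b /=.
under eq_Rintegral do rewrite IH.
by rewrite RintegralD //; exact: threshold_integral_integrable.
Qed.

Lemma threshold_integralZ s a F b : cellwise F ->
  threshold_integral s (fun b => a * F b) b = a * threshold_integral s F b.
Proof.
move=> hF; elim: s b => [//|v s IH] b /=.
under eq_Rintegral do rewrite IH.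
by rewrite RintegralZl //; exact: threshold_integral_integrable.
Qed.

Lemma threshold_integral_ge0 s (F : (V -> R) -> R) b : (forall b, 0 <= F b) ->
  0 <= threshold_integral s F b.
Proof.
by move=> hF; elim: s b => [//|v s IH] b /=; apply: Rintegral_ge0.
Qed.

Lemma eq_threshold_integral s (F G : (V -> R) -> R) b : F =1 G ->
  threshold_integral s F b = threshold_integral s G b.
Proof.
by move=> FG; elim: s b => [//|v s IH] b /=; apply: eq_Rintegral => y _.
Qed.

Lemma cellwise_sum (J : Type) (r : seq J) (P : pred J) F :
  (forall j, cellwise (F j)) -> cellwise (fun b => \sum_(j <- r | P j) F j b).
Proof. by move=> hF b b' hb; apply: eq_bigr => j _; apply: hF. Qed.

Lemma threshold_mean_sum (J : Type) (r : seq J) (P : pred J) F :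
  (forall j, cellwise (F j)) ->
  threshold_mean (fun b => \sum_(j <- r | P j) F j b) =
  \sum_(j <- r | P j) threshold_mean (F j).
Proof.
move=> hF; rewrite /threshold_mean; elim: r => [|j r IH].
  rewrite big_nil -[RHS](threshold_integral_cst (enum V) 0 (fun=> 0)).
  by apply: eq_threshold_integral => b; rewrite big_nil.
rewrite big_cons -IH.
pose G b := if P j then F j b else 0.
transitivity (threshold_integral (enum V)
    (fun b => G b + \sum_(i <- r | P i) F i b) (fun=> 0)).
  by apply: eq_threshold_integral => b; rewrite /G big_cons; case: ifP; rewrite ?add0r.
have hG : cellwise G by rewrite /G; case: (P j).
rewrite (threshold_integralD _ _ hG (cellwise_sum r P hF)) /G.
by case: (P j); rewrite ?threshold_integral_cst ?add0r.
Qed.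

(** Since [enum V] lists [v] exactly once, every other integral is that of a constant. *)
Lemma threshold_mean_coord (v : V) (g : R -> R) :
  threshold_mean (fun b => g (b v)) = \int[unif]_y g y.
Proof.
have notin (s : seq V) b : v \notin s ->
    threshold_integral s (fun b => g (b v)) b = g (b v).
  elim: s b => [//|u s IH] b /=; rewrite inE negb_or => /andP[vu vs].
  under eq_Rintegral do rewrite IH// (negbTE vu).
  by rewrite Rintegral_uniform_cst.
rewrite /threshold_mean; have := mem_enum V v; have := enum_uniq V.
elim: (enum V) (fun _ => 0) => [//|u s IH] b /= /andP[us uniqs].
rewrite inE; have [vu _|vu /= vs] := eqVneq v u.
  by apply: eq_Rintegral => y _; rewrite notin vu ?eqxx.
by under eq_Rintegral do rewrite IH //; rewrite Rintegral_uniform_cst.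
Qed.

Lemma uniform_prob_le (a : R) : 0 <= a <= 1 -> \int[unif]_y ((y : R) <= a)%R%:R = a.
Proof.
move=> /andP[a0 a1].
transitivity (fine (unif `]-oo, a]%classic)).
  have := @integral_indic _ _ _ unif _ measurableT `]-oo, a]%classic (measurable_itv _).
  rewrite setIT => h; rewrite -[X in _ = fine X]h /Rintegral.
  by congr fine; apply: eq_integral => y _; rewrite indicE mem_setE in_itv.
rewrite /uniform_prob integral_uniform_pdf.
have -> : (`]-oo, a] `&` `[0, 1])%classic = `[0, a]%classic :> set R.
  apply/seteqP; split=> y /=; rewrite !in_itv /=; first by move=> [-> /andP[->]].
  by move=> /andP[-> ya]; rewrite ya (le_trans ya).
rewrite (eq_integral (fun=> 1%:E)); last first.
  move=> y; rewrite inE/= in_itv/= /uniform_pdf => /andP[-> /le_trans -> //].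
  by rewrite subr0 invr1.
rewrite integral_cst//= lebesgue_measure_itv/= lte_fin mul1e.
by move: a0; rewrite le_eqVlt => /orP[/eqP <-|->]; rewrite ?ltxx // oppr0 adde0.
Qed.

End Thresholds.

(** * Signs given the activation steps *)

Section Signs.
Context {R : realType} {V : finType}.
Variable E : {set V * V}.
Notation outcome := (@outcome V).

Definition flip (v : V) (o : outcome) : outcome :=
  [ffun u => if u == v then omap (fun p => (p.1, ~~ p.2)) (o u) else o u].

Lemma flipK v : involutive (flip v).
Proof.
move=> o; apply/ffunP => u; rewrite !ffunE; case: eqP => // _.
by case: (o u) => [[m []]|].
Qed.

Lemma act_step_flip v o u : act_step (flip v o) u = act_step o u.
Proof. by rewrite /act_step ffunE; case: ifP => // _; case: (o u). Qed.

Lemma positive_flip_neq v o u : u != v -> positive (flip v o) u = positive o u.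
Proof. by rewrite /positive ffunE => /negbTE ->. Qed.

Lemma positive_flip v o : act_step o v != None ->
  positive (flip v o) v = ~~ positive o v.
Proof. by rewrite /positive /act_step ffunE eqxx; case: (o v). Qed.

Lemma active_at_flip v o tau : active_at (flip v o) tau = active_at o tau.
Proof. by apply/setP => u; rewrite !inE act_step_flip. Qed.

Definition same_steps (o0 o : outcome) := [forall v, act_step o v == act_step o0 v].

Lemma same_steps_flip o0 v o : same_steps o0 (flip v o) = same_steps o0 o.
Proof. by apply: eq_forallb => u; rewrite act_step_flip. Qed.

Lemma sum_flip o0 v (F : outcome -> R) :
  \sum_(o | same_steps o0 o) F o = \sum_(o | same_steps o0 o) F (flip v o).
Proof.
rewrite (reindex_inj (inv_inj (flipK v))) /=.
by apply: eq_bigl => o; rewrite same_steps_flip.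
Qed.

(** [flip v] permutes the outcomes with the steps of [o0], so twice a sum over them is the sum of
    the symmetrized terms. Doubling, instead of choosing one outcome per pair, also covers an
    inactive [v], for which [flip v o] is [o]. *)
Lemma eq_sum_flip o0 v (F G : outcome -> R) :
  (forall o, same_steps o0 o -> F o + F (flip v o) = G o + G (flip v o)) ->
  \sum_(o | same_steps o0 o) F o = \sum_(o | same_steps o0 o) G o.
Proof.
move=> FG; apply: (@mulIf _ 2%:R); first by rewrite pnatr_eq0.
rewrite !mulr_natr !mulr2n {2}(sum_flip o0 v F) {2}(sum_flip o0 v G).
by rewrite -!big_split; apply: eq_bigr.
Qed.

(* 1 if v is inactive or positive: a reference law for the signs, under which
   they are all positive. *)
Definition pos_or_inactive (o : outcome) (v : V) : R :=
  ((act_step o v == None) || positive o v)%:R.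

(** Inactive nodes share rank 0 with the seeds: their factor is 1 and their flip changes nothing, so
    they may be summed out at any point. *)
Definition step_rank (o : outcome) v : nat := odflt 0%N (act_step o v).

(* Summing out the sign of a node of D activated last replaces its factor by
   the reference one. *)
Lemma sum_signs o0 (p : V -> outcome -> R) (D : {set V}) (g : outcome -> R) :
  (forall o v, same_steps o0 o -> p v o + p v (flip v o) =
     pos_or_inactive o v + pos_or_inactive (flip v o) v) ->
  (forall o u v, same_steps o0 o -> u != v ->
     (step_rank o0 u <= step_rank o0 v)%N -> p u (flip v o) = p u o) ->
  (forall o v, v \in D -> same_steps o0 o -> g (flip v o) = g o) ->
  \sum_(o | same_steps o0 o) g o * \prod_(v in D) p v o =
  \sum_(o | same_steps o0 o) g o * \prod_(v in D) pos_or_inactive o v.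
Proof.
move=> hp hrank; have [n] := ubnP #|D|; elim: n D g => // n IH D g hD hg.
have [->|[v0 v0D]] := set_0Vmem D.
  by apply: eq_bigr => o _; rewrite !big_set0.
case: (arg_maxnP (step_rank o0) v0D) => v hvD vmax; have {hvD}vD : v \in D := hvD.
transitivity (\sum_(o | same_steps o0 o)
    (g o * pos_or_inactive o v) * \prod_(u in D :\ v) p u o).
  apply: (@eq_sum_flip _ v) => o ho.
  have hoF : same_steps o0 (flip v o) by rewrite same_steps_flip.
  rewrite !(big_setD1 v vD) /= hg //.
  have -> : \prod_(u in D :\ v) p u (flip v o) = \prod_(u in D :\ v) p u o.
    apply: eq_bigr => u; rewrite !inE => /andP[uv uD].
    by apply: hrank => //; apply: vmax.
  by rewrite !mulrA -!mulrDl -!mulrDr hp.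
(* The reference factor of [v], now part of the weight, ignores the signs of the other nodes, so the
   weight is still invariant under their flips. *)
rewrite IH; last first.
- move=> o u; rewrite !inE => /andP[uv uD] ho; rewrite hg //.
  by rewrite /pos_or_inactive act_step_flip positive_flip_neq // eq_sym.
- by move: hD; rewrite (cardsD1 v) vD add1n ltnS.
by apply: eq_bigr => o _; rewrite [in RHS](big_setD1 v vD) /= mulrA.
Qed.

(** Any outcome with a negative active node has a zero factor, so only [o1] contributes. *)
Lemma sum_all_positive o0 :
  \sum_(o | same_steps o0 o) \prod_(v : V) pos_or_inactive o v = 1.
Proof.
pose o1 : outcome := [ffun v => omap (fun p => (p.1, true)) (o0 v)].
have ho1 : same_steps o0 o1.
  by apply/forallP => v; rewrite /act_step ffunE; case: (o0 v).
rewrite (bigD1 o1) //= [X in _ + X]big1 ?addr0; last first.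
  move=> o /andP[ho no]; apply/eqP; rewrite prodf_seq_eq0; apply/hasP.
  have : ~~ [forall v, o v == o1 v].
    by apply: contra no => /forallP h; apply/eqP/ffunP => v; apply/eqP.
  rewrite negb_forall => /existsP[v ov]; exists v; first by rewrite mem_index_enum.
  rewrite /pos_or_inactive pnatr_eq0 eqb0 negb_or /=.
  move/forallP/(_ v): ho ov; rewrite /positive /act_step ffunE.
  case: (o v) (o0 v) => [[m s]|] [[m' s']|] //= /eqP [mm'].
  by case: s => //; rewrite (ord_inj mm') eqxx.
rewrite big1 // => v _; rewrite /pos_or_inactive /act_step /positive ffunE.
by case: (o0 v).
Qed.

Definition sign_factor (w : V * V -> R) (qp qm : V -> R) (v : V) (o : outcome) : R :=
  match act_step o v with
  | None => 1
  | Some 0%N => (positive o v)%:R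
  | Some tau => if positive o v then pos_prob E w qp qm o v tau
                else 1 - pos_prob E w qp qm o v tau
  end.

Section Model.
Variables (w : V * V -> R) (qp qm : V -> R).

Lemma sign_probE o : sign_prob E w qp qm o = \prod_v sign_factor w qp qm v o.
Proof. by []. Qed.

(** The only signs read by [pos_prob] at step [tau] are those of nodes activated exactly at step
    [tau.-1]. *)
Lemma pos_prob_flip o u v tau : (tau.-1 != step_rank o v)%N ->
  pos_prob E w qp qm (flip v o) u tau = pos_prob E w qp qm o u tau.
Proof.
move=> htau; rewrite /pos_prob active_at_flip.
suff -> : active_at o tau.-1 :&: positives (flip v o) =
          active_at o tau.-1 :&: positives o by [].
apply/setP => z; rewrite !inE; case: eqP => //= hz.
rewrite positive_flip_neq //; apply: contraNneq htau => <-.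
by rewrite /step_rank hz.
Qed.

Lemma same_steps_rank o0 o v : same_steps o0 o -> step_rank o v = step_rank o0 v.
Proof. by move=> /forallP/(_ v)/eqP h; rewrite /step_rank h. Qed.

(** A node is not among its own influencers, so flipping its sign exchanges p and 1 - p for the same
    p. Both laws give total weight 1 to the two signs of an active node, and the factor 1 to an
    inactive one. *)
Lemma sign_factor_flip o v :
  sign_factor w qp qm v o + sign_factor w qp qm v (flip v o) =
  pos_or_inactive o v + pos_or_inactive (flip v o) v.
Proof.
rewrite /sign_factor /pos_or_inactive act_step_flip.
case hv: (act_step o v) => [[|m]|] //=.
have pf : positive (flip v o) v = ~~ positive o v by apply: positive_flip; rewrite hv.
rewrite pos_prob_flip /step_rank ?hv /= ?neq_ltn ?ltnSn // pf.
by case: (positive o v) => /=; rewrite ?subrKC ?subrK ?addr0 ?add0r // addrC subrK.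
Qed.

Lemma sign_factor_flip_neq o u v : u != v -> (step_rank o u <= step_rank o v)%N ->
  sign_factor w qp qm u (flip v o) = sign_factor w qp qm u o.
Proof.
move=> uv; rewrite /sign_factor act_step_flip positive_flip_neq //.
rewrite {1}/step_rank; case: (act_step o u) => [[|m]|] //= h.
by rewrite pos_prob_flip //= neq_ltn h.
Qed.

Lemma sum_sign_prob o0 : \sum_(o | same_steps o0 o) sign_prob E w qp qm o = 1.
Proof.
rewrite -[RHS](sum_all_positive o0).
have prodT (F : V -> R) : \prod_v F v = 1 * \prod_(v in [set: V]) F v.
  by rewrite mul1r; apply: eq_bigl => v; rewrite inE.
under eq_bigr do rewrite sign_probE prodT.
under [RHS]eq_bigr do rewrite prodT.
apply: sum_signs => //; first by move=> o v _; apply: sign_factor_flip.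
by move=> o u v ho uv huv; apply: sign_factor_flip_neq; rewrite ?(same_steps_rank _ ho).
Qed.

(* All the parents activated at step 0 are positive, so that only negative
   autonomy can make a node activated at step 1 negative. *)
Lemma sum_sign_prob_step1 o0 v : act_step o0 v = Some 1%N ->
  in_weight E w (active_at o0 0) v != 0 ->
  \sum_(o | same_steps o0 o)
    sign_prob E w qp qm o * (1 - (positive o v)%:R - qm v) = 0.
Proof.
move=> hv hw.
pose f o : R := if positive o v then 1 - qm v else qm v.
pose g o := f o * (1 - (positive o v)%:R - qm v).
have av o : same_steps o0 o -> act_step o v = Some 1%N.
  by move=> /forallP/(_ v)/eqP ->.
have hsplit o : same_steps o0 o ->
    sign_prob E w qp qm o * (1 - (positive o v)%:R - qm v) =
    g o * \prod_(u in [set~ v]) sign_factor w qp qm u o.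
  move=> ho; rewrite sign_probE (bigD1 v) //=.
  rewrite [X in _ = _ * X](eq_bigl (fun u => u != v)); last by move=> u; rewrite !inE.
  (* A negative seed makes both sides vanish through its own factor. Otherwise all nodes active at
     step 0 are positive, the quotient in [pos_prob] is 1, and the factor of [v] is [f o]. *)
  have [/existsP[u /andP[/eqP hu hpos]]|] :=
      boolP [exists u, (act_step o u == Some 0%N) && ~~ positive o u].
    have uv : u != v by apply: contra_eqN hu => /eqP ->; rewrite av.
    rewrite (bigD1 u) //= {2}/sign_factor [in RHS]/sign_factor hu (negbTE hpos).
    by rewrite !(mul0r, mulr0).
  rewrite negb_exists => /forallP hall.
  have -> : sign_factor w qp qm v o = f o.
    rewrite /sign_factor av // /f /pos_prob /=.
    have -> : active_at o 0 :&: positives o = active_at o 0.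
      apply/setP => u; rewrite !inE; move: (hall u).
      by case: eqP => //= _; rewrite negbK => ->.
    have -> : active_at o 0 = active_at o0 0.
      by apply/setP => u; rewrite !inE (eqP (forallP ho u)).
    rewrite divff // mulr1.
    have -> : qp v + (1 - (qp v + qm v)) = 1 - qm v by ring.
    by case: positive; rewrite // subKr.
  by rewrite /g mulrAC -mulrA mulrC -!mulrA mulrCA !mulrA.
rewrite (eq_bigr _ hsplit) sum_signs; first last.
- move=> o u; rewrite !inE => uv ho.
  by rewrite /g /f positive_flip_neq // eq_sym.
- move=> o u u' ho uv huv.
  by apply: sign_factor_flip_neq; rewrite ?(same_steps_rank _ ho).
- by move=> o u _; apply: sign_factor_flip.
(* With q for [qm v], the positive and the negative sign of [v] contribute -(1 - q) q and q (1 -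
   q). *)
transitivity (\sum_(o | same_steps o0 o) (0 : R)); last by rewrite big1.
apply: (@eq_sum_flip _ v) => o ho.
have -> : \prod_(u in [set~ v]) pos_or_inactive (flip v o) u =
          \prod_(u in [set~ v]) pos_or_inactive o u.
  apply: eq_bigr => u; rewrite !inE => uv.
  by rewrite /pos_or_inactive act_step_flip positive_flip_neq.
rewrite -mulrDl /g /f positive_flip ?av //.
by case: positive => /=; ring.
Qed.

End Model.
End Signs.

(** * Law of a diffusion *)

Section Diffusion.
Context {R : realType} {V : finType}.
Variables (E : {set V * V}) (w : V * V -> R) (qp qm : V -> R).
Notation outcome := (@outcome V).
Notation unif := (uniform_prob (@ltr01 R)).

(** [active] uses a threshold only by comparing it with such weights, so these are the cut points,
    indexed by the finitely many sets [A]. *)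
Definition cut (v : V) (A : {set V}) : R := in_weight E w A v.

Definition follows S b (o : outcome) :=
  [forall tau : 'I_#|V|.+1, active E w S b tau == active_by o tau].

Lemma active_cellwise S b b' tau :
  (forall v, same_cell cut v (b v) (b' v)) ->
  active E w S b tau = active E w S b' tau.
Proof.
move=> hb; elim: tau => //= tau ->.
by congr (_ :|: _); apply/setP => v; rewrite !inE; apply: hb.
Qed.

Lemma active_mono S b s t : (s <= t)%N ->
  active E w S b s \subset active E w S b t.
Proof.
move/subnK <-; elim: (t - s)%N => [|k IH]; first by rewrite add0n.
by rewrite addSn /= (fintype.subset_trans IH) // finset.subsetUl.
Qed.

(* A representative of the outcomes whose activation steps are those
   prescribed by b; its signs are irrelevant. *)
Definition run S (b : V -> R) : outcome :=
  [ffun v => omap (fun tau => (tau, true))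
     [pick tau : 'I_#|V|.+1 | (v \in active E w S b tau) &&
        [forall s : 'I_#|V|.+1, (v \in active E w S b s) ==> (tau <= s)%N]]].

Lemma active_run S b (tau : nat) : (tau <= #|V|)%N ->
  active_by (run S b) tau = active E w S b tau.
Proof.
move=> htau; apply/setP => v; rewrite !inE /act_step ffunE.
case: pickP => [t /andP[vt /forallP tmin]|none] /=.
  apply/idP/idP => [tle|vtau]; first by apply: (fintype.subsetP (active_mono S b tle)).
  have := tmin (Ordinal (htau : (tau < #|V|.+1)%N)).
  by rewrite /= vtau.
apply/esym/negbTE/negP => vtau.
pose t0 : 'I_#|V|.+1 := Ordinal (htau : (tau < #|V|.+1)%N).
have ht0 : v \in active E w S b t0 by [].
case: (@arg_minnP _ t0 (fun t : 'I_#|V|.+1 => v \in active E w S b t) val ht0) => t vt tmin.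
have := none t; rewrite vt /= => /negP; apply.
by apply/forallP => s; apply/implyP; apply: tmin.
Qed.

(** The step of a node is the least [tau] for which [active_by] contains it; [le_step] compares
    these least steps, in both directions. *)
Lemma eq_act_step (o o' : outcome) :
  (forall tau : 'I_#|V|.+1, active_by o tau = active_by o' tau) ->
  forall v, act_step o v = act_step o' v.
Proof.
have le_step (o1 o2 : outcome) v (m : 'I_#|V|.+1) s :
    (forall tau : 'I_#|V|.+1, active_by o1 tau = active_by o2 tau) ->
    o1 v = Some (m, s) -> exists m' : 'I_#|V|.+1, exists s',
      o2 v = Some (m', s') /\ (m' <= m)%N.
  move=> h h1; have /setP/(_ v) := h m; rewrite !inE /act_step h1 /= leqnn.
  by case: (o2 v) => [[m' s']|] //= h2; exists m', s'.
move=> h v; rewrite /act_step.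
case ho: (o v) => [[m s]|]; case ho': (o' v) => [[m' s']|] //=.
- have [m1 [s1 [h1 m1m]]] := le_step _ _ _ _ _ h ho.
  have [m2 [s2 [h2 m2m]]] := le_step _ _ _ _ _ (fun t => esym (h t)) ho'.
  move: h1 h2; rewrite ho ho' => -[e1 _] [e2 _].
  by congr Some; apply/eqP; rewrite eqn_leq {1}e2 {2}e1 m2m m1m.
- by have [m1 [s1 []]] := le_step _ _ _ _ _ h ho; rewrite ho'.
- by have [m1 [s1 []]] := le_step _ _ _ _ _ (fun t => esym (h t)) ho'; rewrite ho.
Qed.

(** Identifies the event inside [outcome_prob] with a class of outcomes over which signs can be
    summed out. *)
Lemma followsE S b o : follows S b o = same_steps (run S b) o.
Proof.
apply/forallP/forallP => [h v|h tau].
  apply/eqP/eq_act_step => tau; rewrite active_run; last by rewrite -ltnS.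
  exact/esym/eqP.
rewrite -active_run; last by rewrite -ltnS.
by apply/eqP/setP => v; rewrite !inE (eqP (h v)).
Qed.

Lemma active_at_run0 S b : active_at (run S b) 0 = S.
Proof.
apply/setP => v; have /setP/(_ v) := @active_run S b 0 isT; rewrite /= !inE => <-.
by case: act_step => [[|m]|].
Qed.

Lemma act_step_run1 (S : {set V}) b v : v \notin S ->
  (act_step (run S b) v == Some 1%N) = (b v <= in_weight E w S v).
Proof.
move=> vS; have cV : (1 <= #|V|)%N by apply/card_gt0P; exists v.
have /setP/(_ v) := @active_run S b 1 cV; rewrite /= !inE (negbTE vS) /= => <-.
have /setP/(_ v) := @active_run S b 0 isT; rewrite /= !inE (negbTE vS).
by case: act_step => [[|[|m]]|].
Qed.

(** Conditioning on the thresholds: they determine all activation steps, and only the signs remain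
    random. *)
Lemma sum_outcome_prob S (X : outcome -> R) :
  \sum_o outcome_prob E w qp qm S o * X o =
  threshold_mean (fun b =>
    \sum_(o | same_steps (run S b) o) sign_prob E w qp qm o * X o).
Proof.
have cF o : cellwise cut (fun b => (follows S b o)%:R * sign_prob E w qp qm o).
  move=> b b' hb; congr (_%:R * _); congr nat_of_bool; apply: eq_forallb => tau.
  by rewrite (active_cellwise _ _ hb).
transitivity (threshold_mean (fun b =>
    \sum_o X o * ((follows S b o)%:R * sign_prob E w qp qm o))).
  rewrite (@threshold_mean_sum _ _ _ cut); last first.
    by move=> o b b' hb; rewrite (cF o _ _ hb).
  apply: eq_bigr => o _; rewrite mulrC /threshold_mean.
  by rewrite (threshold_integralZ _ _ _ (cF o)).
apply: eq_threshold_integral => b; rewrite [RHS]big_mkcond.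
apply: eq_bigr => o _; rewrite followsE.
by case: same_steps; rewrite ?mul1r ?mul0r ?mulr0 // mulrC.
Qed.

Lemma outcome_prob_sum1 S : \sum_o outcome_prob E w qp qm S o = 1.
Proof.
under eq_bigr do rewrite -[outcome_prob _ _ _ _ _ _]mulr1.
rewrite sum_outcome_prob.
rewrite -[RHS](@threshold_integral_cst _ _ (enum V) 1 (fun=> 0)).
apply: eq_threshold_integral => b; under eq_bigr do rewrite mulr1.
exact: sum_sign_prob.
Qed.

Hypothesis hw01 : forall e, e \in E -> 0 <= w e <= 1.
Hypothesis hwsum : forall v, in_weight E w [set: V] v <= 1.
Hypothesis hqp : forall v, 0 <= qp v.
Hypothesis hqm : forall v, 0 <= qm v.
Hypothesis hqsum : forall v, qp v + qm v <= 1.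

Lemma in_weight_le (A B : {set V}) v :
  A \subset B -> in_weight E w A v <= in_weight E w B v.
Proof.
move=> AB; rewrite /in_weight.
rewrite [leRHS](big_setID A) /= -finset.setIA (finset.setIidPr AB) lerDl.
by apply: sumr_ge0 => u; rewrite !inE => /andP[_ /andP[/hw01/andP[]]].
Qed.

Lemma in_weight_ge0 A v : 0 <= in_weight E w A v.
Proof. by apply: sumr_ge0 => u; rewrite !inE => /andP[/hw01/andP[]]. Qed.

Lemma in_weight_le1 A v : in_weight E w A v <= 1.
Proof. by apply: le_trans (hwsum v); apply: in_weight_le; rewrite finset.subsetT. Qed.

Lemma pos_prob_itv o v tau : 0 <= pos_prob E w qp qm o v tau <= 1.
Proof.
rewrite /pos_prob; set A := active_at o _.
set r := _ / _.
have r0 : 0 <= r by rewrite divr_ge0 // in_weight_ge0.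
have r1 : r <= 1.
  (* A zero denominator gives the quotient the value 0. *)
  have := in_weight_ge0 A v; rewrite le_eqVlt /r => /orP[/eqP <-|A0].
    by rewrite invr0 mulr0.
  by rewrite ler_pdivrMr // mul1r in_weight_le // finset.subsetIl.
have h1 := hqp v; have h2 := hqm v; have h3 := hqsum v.
by apply/andP; split; nra.
Qed.

Lemma outcome_prob_ge0 S o : 0 <= outcome_prob E w qp qm S o.
Proof.
apply: threshold_integral_ge0 => b; apply: mulr_ge0; first exact: ler0n.
apply: prodr_ge0 => v _; case: act_step => [[|tau]|] //.
have /andP[h0 h1] := pos_prob_itv o v tau.+1.
by case: ifP => // _; rewrite subr_ge0.
Qed.

(** Given the thresholds, activation of [v] at step 1 amounts to [b v <= in_weight E w S v] and the
    signs have total mass 1. What remains is the law of one uniform threshold. *)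
Lemma activation_prob (S : {set V}) v : v \notin S ->
  \sum_o outcome_prob E w qp qm S o * (act_step o v == Some 1%N)%:R =
  in_weight E w S v.
Proof.
move=> vS; rewrite sum_outcome_prob.
rewrite -[RHS](@uniform_prob_le R); last by rewrite in_weight_ge0 in_weight_le1.
rewrite -(@threshold_mean_coord R _ v (fun y => ((y : R) <= in_weight E w S v)%R%:R)).
apply: eq_threshold_integral => b.
rewrite -(act_step_run1 b vS) -[RHS]mul1r -(sum_sign_prob E w qp qm (run S b)).
by rewrite mulr_suml; apply: eq_bigr => o /forallP/(_ v)/eqP ->.
Qed.

(** The conditional mean vanishes for every choice of thresholds: either the indicator is 0, or
    [sum_sign_prob_step1] applies, the positive weight excluding the quotient 0 / 0. *)
Lemma sign_residual (S : {set V}) v : v \notin S -> 0 < in_weight E w S v ->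
  \sum_o outcome_prob E w qp qm S o *
    ((act_step o v == Some 1%N)%:R * (1 - (positive o v)%:R - qm v)) = 0.
Proof.
move=> vS w0; rewrite sum_outcome_prob.
rewrite -[RHS](@threshold_integral_cst _ _ (enum V) 0 (fun=> 0)).
apply: eq_threshold_integral => b.
have [h1|h1] := boolP (act_step (run S b) v == Some 1%N); last first.
  rewrite big1 // => o /forallP/(_ v)/eqP ->.
  by rewrite (negbTE h1) mul0r mulr0.
rewrite -[RHS](@sum_sign_prob_step1 _ _ E w qp qm _ _ (eqP h1)).
  by apply: eq_bigr => o /forallP/(_ v)/eqP ->; rewrite h1 mul1r.
by rewrite active_at_run0 gt_eqF.
Qed.

End Diffusion.

(** * Concentration along a policy *)

(** On the one hand exp(x) (1 - x) <= exp(x) exp(-x) = 1; on the other, (1 + x + 2 x^2) (1 - x) = 1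
    + x^2 (1 - 2 x) >= 1. *)
Lemma expR_le_quadratic (R : realType) (x : R) : `|x| <= 2^-1 ->
  expR x <= 1 + x + 2 * x ^+ 2.
Proof.
rewrite ler_norml => /andP[xl xr].
have h : 1 - x <= expR (- x) by have := expR_ge1Dx (- x).
have xe : expR x * expR (- x) = 1 by rewrite -expRD subrr expR0.
have e0 := expR_gt0 x.
have : expR x * (1 - x) <= 1 by rewrite -[leRHS]xe ler_pM2l.
have : 1 <= (1 + x + 2 * x ^+ 2) * (1 - x).
  have -> : (1 + x + 2 * x ^+ 2) * (1 - x) = 1 + x ^+ 2 * (1 - 2 * x) by ring.
  by rewrite lerDl mulr_ge0 ?sqr_ge0 //; lra.
move=> h1 h2; have x1 : 0 < 1 - x by lra.
by have := le_trans h2 h1; rewrite ler_pM2r.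
Qed.

Section History.
Context {R : realType} {V : finType}.
Variables (E : {set V * V}) (w : V * V -> R) (qp qm : V -> R).
Notation outcome := (@outcome V).
Notation prob := (outcome_prob E w qp qm).
Hypothesis prob_ge0 : forall S o, 0 <= prob S o.
Hypothesis prob_sum1 : forall S, \sum_o prob S o = 1.
Variable pi : @policy R V.
Hypothesis pi_pmf : forall h, is_pmf (pi h).

Notation hm := (history_mean E pi w qp qm).

(** Only histories of length [n] occur, and the restriction matters: the algorithm reads the round
    number off the length. *)
Lemma history_mean_le n (F G : seq outcome -> R) :
  (forall h, size h = n -> F h <= G h) -> hm n F <= hm n G.
Proof.
elim: n F G => [|n IH] F G FG /=; first exact: FG.
apply: IH => h hn; apply: ler_sum => S _.
apply: ler_wpM2l; first by case: (pi_pmf h).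
apply: ler_sum => o _; apply: ler_wpM2l => //.
by apply: FG; rewrite size_rcons hn.
Qed.

Lemma eq_history_mean n (F G : seq outcome -> R) :
  (forall h, size h = n -> F h = G h) -> hm n F = hm n G.
Proof.
by move=> FG; apply/eqP; rewrite eq_le !history_mean_le // => h hn; rewrite FG.
Qed.

Lemma history_meanZ n a (F : seq outcome -> R) :
  hm n (fun h => a * F h) = a * hm n F.
Proof.
elim: n F => [//|n IH] F /=; rewrite -IH; apply: eq_history_mean => h _.
rewrite mulr_sumr; apply: eq_bigr => S _; rewrite mulrCA; congr (_ * _).
by rewrite mulr_sumr; apply: eq_bigr => o _; rewrite mulrCA.
Qed.

Lemma history_meanD n (F G : seq outcome -> R) :
  hm n (fun h => F h + G h) = hm n F + hm n G.
Proof.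
elim: n F G => [//|n IH] F G /=; rewrite -IH; apply: eq_history_mean => h _.
rewrite -big_split /=; apply: eq_bigr => S _; rewrite -mulrDr; congr (_ * _).
by rewrite -big_split /=; apply: eq_bigr => o _; rewrite -mulrDr.
Qed.

Lemma history_mean_cst n (a : R) : hm n (fun=> a) = a.
Proof.
elim: n => [//|n IH] /=; rewrite -[RHS]IH; apply: eq_history_mean => h _.
rewrite (eq_bigr (fun S => pi h S * a)); last first.
  by move=> S _; rewrite -mulr_suml prob_sum1 mul1r.
by rewrite -mulr_suml; case: (pi_pmf h) => _ ->; rewrite mul1r.
Qed.

Lemma history_mean_sum n (J : Type) (r : seq J) (F : J -> seq outcome -> R) :
  hm n (fun h => \sum_(j <- r) F j h) = \sum_(j <- r) hm n (F j).
Proof.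
elim: r => [|j r IH].
  rewrite big_nil -[RHS](history_mean_cst n).
  by apply: eq_history_mean => h _; rewrite big_nil.
rewrite big_cons -IH -history_meanD.
by apply: eq_history_mean => h _; rewrite big_cons.
Qed.

(* Rounds rs are played with the same deterministic seed set, so that a centred
   statistic of their outcomes has martingale partial sums. *)
Section Concentration.
Variables (rs : seq nat) (S0 : {set V}) (g : outcome -> R).
Hypothesis uniq_rs : uniq rs.
Hypothesis rs_gt0 : forall t, t \in rs -> (0 < t)%N.
Hypothesis rs_seed : forall t h, t \in rs -> size h = t.-1 -> pi h = point_mass S0.
Hypothesis g_mean : \sum_o prob S0 o * g o = 0.
Hypothesis g_le1 : forall o, `|g o| <= 1.

(** In the quadratic bound the linear term has mean 0 and [g o ^+ 2 <= 1], which leaves 1 + 2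
    s^2. *)
Lemma outcome_mgf (s : R) : `|s| <= 2^-1 ->
  \sum_o prob S0 o * expR (s * g o) <= expR (2 * s ^+ 2).
Proof.
move=> hs; apply: le_trans (expR_ge1Dx _).
have -> : 1 + 2 * s ^+ 2 =
    \sum_o (prob S0 o * (1 + 2 * s ^+ 2) + s * (prob S0 o * g o)).
  by rewrite big_split /= -mulr_suml -mulr_sumr prob_sum1 g_mean mulr0 addr0 mul1r.
apply: ler_sum => o _; rewrite [X in _ <= _ + X]mulrCA -mulrDr ler_wpM2l //.
have hg := g_le1 o.
apply: (le_trans (expR_le_quadratic _)).
  by rewrite normrM (le_trans _ hs) // ler_piMr.
have g2 : g o ^+ 2 <= 1 by rewrite -real_normK ?num_real // expr_le1.
rewrite exprMn; have := sqr_ge0 s; nra.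
Qed.

(** Supermartingale argument: at a round of [rs] the seed set is [S0] whatever the past, so the
    conditional mean gains at most the factor exp(2 s^2). Any other round leaves the sum
    unchanged. *)
Lemma history_mgf n (s : R) : `|s| <= 2^-1 ->
  hm n (fun h => expR (s * \sum_(t <- rs | (t <= n)%N) g (round h t))) <=
  expR (2 * s ^+ 2 * (count (fun t => t <= n)%N rs)%:R).
Proof.
move=> hs; elim: n => [|n IH] /=.
  rewrite big_seq_cond big_pred0 ?mulr0 ?expR0.
    rewrite -[leLHS]expR0 ler_expR; apply: mulr_ge0; last exact: ler0n.
    by apply: mulr_ge0; rewrite ?ler0n ?sqr_ge0.
  by move=> t; apply/negbTE/negP => /andP[/rs_gt0]; case: t.
have cnt : count (fun t => t <= n.+1)%N rs =
    (count (fun t => t <= n)%N rs + (n.+1 \in rs))%N.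
  rewrite -(count_uniq_mem _ uniq_rs) -!size_filter -size_cat.
  rewrite !size_filter size_cat !size_filter.
  rewrite -count_predUI [X in (_ + X)%N](eq_count (a2 := pred0)) ?count_pred0 ?addn0.
    by apply: eq_count => t /=; rewrite leq_eqVlt ltnS orbC.
  by move=> t /=; case: eqP => [->|]; rewrite ?ltnn ?andbF.
rewrite cnt natrD mulrDr expRD mulrC.
rewrite -(ler_pM2l (expR_gt0 (2 * s ^+ 2 * (n.+1 \in rs)%:R))) in IH.
apply: le_trans IH; rewrite -history_meanZ; apply: history_mean_le => h hn.
have split_sum o : \sum_(t <- rs | (t <= n.+1)%N) g (round (rcons h o) t) =
    \sum_(t <- rs | (t <= n)%N) g (round h t) + (n.+1 \in rs)%:R * g o.
  have -> : (n.+1 \in rs)%:R * g o = \sum_(t <- rs | t == n.+1) g o.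
    rewrite big_const_seq -(count_uniq_mem _ uniq_rs) iter_addr_0 mulr_natl.
    by congr (_ *+ _); apply: eq_count.
  rewrite (bigID (fun t => t == n.+1)) /= addrC; congr (_ + _).
    rewrite big_seq_cond [RHS]big_seq_cond.
    apply: eq_big => [t|t /andP[trs /andP[tn tn1]]].
      case: (t \in rs) => //=; rewrite leq_eqVlt ltnS.
      by case: (eqVneq t n.+1) => [->|_] /=; rewrite ?ltnn ?andbT.
    have tn' : (t <= n)%N by rewrite -ltnS ltn_neqAle tn1.
    rewrite /round nth_rcons hn; have := rs_gt0 trs.
    by case: t tn' {trs tn tn1} => //= t ->.
  apply: eq_big => [t|t /andP[_ /eqP ->]].
    by case: eqP => [->|]; rewrite ?leqnn ?andbF.
  by rewrite /round nth_rcons hn /= ltnn eqxx.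
set W := \sum_(t <- rs | (t <= n)%N) g (round h t) in split_sum *.
(* [W] is determined by the past, so [expR (s * W)] leaves the mean over the new round. *)
have -> : \sum_S pi h S * (\sum_o prob S o *
      expR (s * \sum_(t <- rs | (t <= n.+1)%N) g (round (rcons h o) t))) =
   (\sum_S pi h S * (\sum_o prob S o * expR (s * ((n.+1 \in rs)%:R * g o)))) * expR (s * W).
  rewrite mulr_suml; apply: eq_bigr => S _; rewrite -mulrA; congr (_ * _).
  rewrite mulr_suml; apply: eq_bigr => o _; rewrite -mulrA; congr (_ * _).
  by rewrite split_sum mulrDr expRD mulrC.
rewrite ler_pM2r ?expR_gt0 //.
have [nrs|nrs] := boolP (n.+1 \in rs); last first.
  rewrite mulr0 expR0 (eq_bigr (pi h)); first by case: (pi_pmf h) => _ ->.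
  move=> S _; rewrite (eq_bigr (prob S)) ?prob_sum1 ?mulr1 // => o _.
  by rewrite mul0r mulr0 expR0 mulr1.
rewrite mulr1 (rs_seed nrs) // (bigD1 S0) //= [X in _ + X]big1 ?addr0.
  rewrite /point_mass eqxx mul1r.
  by under eq_bigr do rewrite mul1r; exact: outcome_mgf.
by move=> S /negbTE hS; rewrite /point_mass hS mul0r.
Qed.

Lemma history_upper_tail n (delta : R) : 0 < delta <= 1 ->
  (forall t, t \in rs -> (t <= n)%N) ->
  hm n (fun h => (delta * (size rs)%:R <= \sum_(t <- rs) g (round h t))%R%:R) <=
  expR (- (delta ^+ 2 / 8 * (size rs)%:R)).
Proof.
move=> /andP[d0 d1] hrs.
(* The minimizer of - s delta + 2 s^2, with minimum - delta^2 / 8; [delta <= 1] keeps it below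
   1/2. *)
pose s := delta / 4.
have hs : `|s| <= 2^-1 by rewrite ger0_norm /s; lra.
have := history_mgf n hs.
have -> : count (fun t => (t <= n)%N) rs = size rs.
  by apply/eqP; rewrite -all_count; apply/allP.
move=> hmgf; pose k : R := (size rs)%:R; rewrite -/k in hmgf *.
have -> : - (delta ^+ 2 / 8 * k) = - (s * delta * k) + 2 * s ^+ 2 * k.
  by rewrite /s; field.
rewrite expRD -(ler_pM2l (expR_gt0 (- (s * delta * k)))) in hmgf *.
apply: le_trans hmgf; rewrite -history_meanZ; apply: history_mean_le => h _.
rewrite -expRD.
have -> : \sum_(t <- rs | (t <= n)%N) g (round h t) = \sum_(t <- rs) g (round h t).
  rewrite big_seq_cond [RHS]big_seq; apply: eq_bigl => t.
  by case: (boolP (t \in rs)) => // /hrs ->.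
case: (leP (delta * k)) => hle; last exact: expR_ge0.
rewrite -[leLHS]expR0 ler_expR addrC subr_ge0 -mulrA ler_wpM2l //.
by rewrite /s; lra.
Qed.

End Concentration.

Lemma history_tail rs S0 (g : outcome -> R) n (delta : R) :
  uniq rs -> (forall t, t \in rs -> (0 < t <= n)%N) ->
  (forall t h, t \in rs -> size h = t.-1 -> pi h = point_mass S0) ->
  \sum_o prob S0 o * g o = 0 -> (forall o, `|g o| <= 1) -> 0 < delta <= 1 ->
  hm n (fun h => (delta * (size rs)%:R <= `|\sum_(t <- rs) g (round h t)|)%R%:R) <=
  2 * expR (- (delta ^+ 2 / 8 * (size rs)%:R)).
Proof.
move=> urs hrs seed g0 g1 hd.
have up := @history_upper_tail rs S0 g urs _ seed g0 g1 n delta hd.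
have dn := @history_upper_tail rs S0 (fun o => - g o) urs _ seed _ _ n delta hd.
rewrite mulr_natl mulr2n.
apply: le_trans (lerD (up _ _) (dn _ _ _ _)).
- rewrite -history_meanD; apply: history_mean_le => h _.
  rewrite sumrN -natrD ler_nat.
  case: (lerP (delta * _) `|_|) => //.
  by rewrite ler_normr; case/orP => ->; rewrite ?addn1 ?add1n.
- by move=> t /hrs /andP[].
- by move=> t /hrs /andP[].
- by move=> t /hrs /andP[].
- by under eq_bigr do rewrite mulrN; rewrite sumrN g0 oppr0.
- by move=> o; rewrite normrN.
- by move=> t /hrs /andP[].
Qed.

End History.

(** * Epochs *)

Section Schedule.
Variables d d' q : nat.

Notation start := (epoch_start d d' q).

Lemma epoch_startS k : (0 < k)%N -> start k.+1 = (start k + (d + d' + k ^ q))%N.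
Proof. by move=> k0; rewrite /epoch_start big_nat_recr //= addSn. Qed.

Lemma epoch_start_ltS k : (0 < k)%N -> (start k < start k.+1)%N.
Proof. by move=> k0; rewrite epoch_startS // -addn1 leq_add2l addn_gt0 expn_gt0 k0 orbT. Qed.

Lemma epoch_start_le m k : (0 < m <= k)%N -> (start m <= start k)%N.
Proof.
case/andP=> m0 /subnK <-; elim: (k - m)%N => [|j IH]; first by rewrite add0n.
by rewrite addSn (leq_trans IH) // ltnW // epoch_start_ltS // addn_gt0 m0 orbT.
Qed.

Lemma leq_epoch_start k : (0 < k)%N -> (k <= start k)%N.
Proof.
case: k => // k _; elim: k => [|k IH] //.
exact: leq_ltn_trans IH (epoch_start_ltS (ltn0Sn k)).
Qed.

Lemma epoch_of_eq k t : (0 < k)%N -> (start k <= t < start k.+1)%N ->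
  epoch_of d d' q t = k.
Proof.
move=> k0 /andP[kt tk]; apply/eqP; rewrite eqn_leq; apply/andP; split.
  apply/bigmax_leqP_seq => j; rewrite mem_index_iota => /andP[j0 _] jt.
  rewrite leqNgt; apply/negP => kj.
  have := @epoch_start_le k.+1 j; rewrite kj => /(_ isT) h.
  by have := leq_trans tk (leq_trans h jt); rewrite ltnn.
apply: (@leq_bigmax_seq _ _ _ id k) => //.
by rewrite mem_index_iota k0 ltnS (leq_trans (leq_epoch_start k0)).
Qed.

Lemma epoch_ofP t : (0 < t)%N ->
  (0 < epoch_of d d' q t)%N /\
  (start (epoch_of d d' q t) <= t < start (epoch_of d d' q t).+1)%N.
Proof.
move=> t0; suff [k k0 hk] : exists2 k, (0 < k)%N & (start k <= t < start k.+1)%N.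
  by rewrite (epoch_of_eq k0 hk).
case: t t0 => // t _; elim: t => [|t [k k0 /andP[kt tk]]].
  exists 1%N => //; rewrite (@epoch_startS 1) // /epoch_start big_geq //.
  by rewrite exp1n !addnS.
move: tk; rewrite leq_eqVlt => /orP[/eqP tk|tk].
  by exists k.+1 => //; rewrite -tk leqnn tk epoch_start_ltS.
by exists k => //; rewrite tk (leq_trans kt).
Qed.

Lemma epoch_of_add k j : (0 < k)%N -> (j < d + d' + k ^ q)%N ->
  epoch_of d d' q (start k + j) = k.
Proof.
by move=> k0 jk; apply: epoch_of_eq => //; rewrite leq_addr epoch_startS // ltn_add2l.
Qed.

Lemma phase_of_edge k (i : 'I_d) : (0 < k)%N ->
  phase_of d d' q (@edge_round d d' q k i) = EdgeExploration d' i.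
Proof.
move=> k0; rewrite /phase_of /edge_round epoch_of_add //.
  by rewrite addKn valK.
by rewrite -addnA (leq_trans (ltn_ord i)) // leq_addr.
Qed.

Lemma phase_of_auton k (i : 'I_d') : (0 < k)%N ->
  phase_of d d' q (@auton_round d d' q k i) = AutonomyExploration d i.
Proof.
move=> k0; rewrite /phase_of /auton_round -addnA epoch_of_add //.
  by rewrite addKn insubN -?leqNgt ?leq_addr // addKn valK.
by rewrite -addnA ltn_add2l (leq_trans (ltn_ord i)) // leq_addr.
Qed.

Lemma phase_of_exploit k j : (0 < k)%N -> (j < k ^ q)%N ->
  phase_of d d' q (start k + (d + d' + j)) = Exploitation.
Proof.
move=> k0 jk; rewrite /phase_of epoch_of_add ?ltn_add2l // addKn.
rewrite insubN -?leqNgt -?addnA ?leq_addr //.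
by rewrite addKn insubN // -leqNgt leq_addr.
Qed.

(** Hence all samples behind the estimates used at round [t] lie strictly before [t]. *)
Lemma exploit_after t : (0 < t)%N -> phase_of d d' q t = Exploitation ->
  (start (epoch_of d d' q t) + (d + d') <= t)%N.
Proof.
move=> /epoch_ofP[_ /andP[h _]].
rewrite /phase_of; case: insubP => //= h1; case: insubP => //= h2 _.
by move: h1 h2; rewrite -!leqNgt => h1 h2; lia.
Qed.

Lemma edge_round_inj (i : 'I_d) :
  {in [pred m | 0 < m]%N &, injective ((@edge_round d d' q)^~ i)}.
Proof.
move=> m k m0 k0 /= h.
have ei j : (0 < j)%N -> epoch_of d d' q (@edge_round d d' q j i) = j.
  move=> j0; apply: epoch_of_add => //.
  by rewrite -addnA (leq_trans (ltn_ord i)) // leq_addr.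
by rewrite -(ei m) // h ei.
Qed.

Lemma auton_round_inj (i : 'I_d') :
  {in [pred m | 0 < m]%N &, injective ((@auton_round d d' q)^~ i)}.
Proof.
move=> m k m0 k0 /= h.
have ei j : (0 < j)%N -> epoch_of d d' q (@auton_round d d' q j i) = j.
  move=> j0; rewrite /auton_round -addnA; apply: epoch_of_add => //.
  by rewrite -addnA ltn_add2l (leq_trans (ltn_ord i)) // leq_addr.
by rewrite -(ei m) // h ei.
Qed.

(** The mean value bound for the power p + 1 on [k, k + 1]. *)
Lemma expnSS_le k p : (k.+1 ^ p.+1 <= k ^ p.+1 + p.+1 * k.+1 ^ p)%N.
Proof.
elim: p => [|p IH]; first by rewrite !expn1 expn0 muln1 addn1.
rewrite expnS (leq_trans (leq_mul (leqnn k.+1) IH)) // mulnDr.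
rewrite [in leqRHS]expnS mulSn -addnA addnC -addnA leq_add2l.
rewrite mulnCA -expnS [in leqRHS]mulSn addnC leq_add2r.
by rewrite leq_exp2r.
Qed.

(** Telescopes [expnSS_le]. The epoch ending where epoch k + 1 starts has only k^q exploitation
    rounds; the factor 2^q pays for (k + 1)^q <= 2^q k^q. *)
Lemma expn_le_epoch_start k : (0 < k)%N ->
  (k ^ q.+1 <= q.+1 * 2 ^ q * start k)%N.
Proof.
case: k => // k _; elim: k => [|k IH].
  by rewrite exp1n muln_gt0 muln_gt0 expn_gt0.
rewrite epoch_startS // mulnDr (leq_trans (expnSS_le _ _)) // leq_add //.
rewrite -mulnA leq_mul2l (leq_trans (_ : _ <= 2 ^ q * k.+1 ^ q)%N) //.
  by rewrite -expnMn; case: (q) => // q'; rewrite leq_exp2r //; lia.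
by rewrite leq_mul2l leq_addl orbT.
Qed.

Lemma sum_rounds (R : realType) (b : nat -> R) k :
  \sum_(1 <= t < start k.+1) b t =
  \sum_(1 <= m < k.+1) \sum_(j < d + d' + m ^ q) b (start m + j)%N.
Proof.
elim: k => [|k IH]; first by rewrite [RHS]big_geq // /epoch_start !big_geq.
rewrite [RHS]big_nat_recr //= -IH.
rewrite (@big_cat_nat _ _ _ (start k.+1)) //=; last by rewrite ltnW // epoch_start_ltS.
congr (_ + _); rewrite -{1}[start k.+1]add0n big_addn epoch_startS // addKn.
by rewrite big_mkord; apply: eq_bigr => j _; rewrite addnC.
Qed.

End Schedule.

(** * From a bound per epoch to an average over rounds *)

Section Average.
Variables (R : realType) (d d' q : nat).

Notation start := (epoch_start d d' q).

(* With k the epoch of round T, k ^ (q + 1) = O(T). *)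
Lemma epoch_of_powR : exists2 A : R, 0 <= A & forall T, (0 < T)%N ->
  T%:R^-1 * (epoch_of d d' q T)%:R <= A * T%:R `^ (- (q%:R / q.+1%:R)).
Proof.
pose N : R := (q.+1 * 2 ^ q)%:R; pose r : R := q.+1%:R^-1.
exists (N `^ r); first exact: powR_ge0.
move=> T T0; set k := epoch_of _ _ _ _.
have [k0 /andP[kT _]] := epoch_ofP d d' q T0.
have hk : (k%:R : R) ^+ q.+1 <= N * T%:R.
  rewrite -natrX -natrM ler_nat (leq_trans (expn_le_epoch_start d d' q k0)) //.
  by rewrite leq_mul2l kT orbT.
have r0 : 0 <= r by rewrite invr_ge0.
have qr : q.+1%:R * r = 1 by rewrite mulfV // pnatr_eq0.
have TR : 0 < (T%:R : R) by rewrite ltr0n.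
have k_le : k%:R <= N `^ r * T%:R `^ r.
  have -> : k%:R = (k%:R ^+ q.+1) `^ r :> R.
    by rewrite -powR_mulrn ?ler0n // -powRrM qr powRr1 ?ler0n.
  rewrite -powRM ?ler0n // ge0_ler_powR // nnegrE; first by rewrite exprn_ge0.
  by rewrite mulr_ge0.
have -> : - (q%:R / q.+1%:R) = -1 + r :> R.
  by rewrite /r -natr1; field; rewrite natr1 pnatr_eq0.
rewrite powRD; last by rewrite (gt_eqF TR) implybT.
by rewrite powR_inv1 ?ler0n // mulrCA ler_wpM2l // invr_ge0 ltW.
Qed.

Lemma epoch_average (b : nat -> R) (D C : R) : 0 <= D -> 0 <= C ->
  (forall t, (0 < t)%N -> b t <= D) ->
  (forall t, (0 < t)%N -> phase_of d d' q t = Exploitation ->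
     b t <= C / (epoch_of d d' q t)%:R ^+ q) ->
  exists A, forall T, (0 < T)%N ->
    T%:R^-1 * \sum_(1 <= t < T.+1) b t <= A * T%:R `^ (- (q%:R / q.+1%:R)).
Proof.
move=> D0 C0 bD bC.
(* Unlike [b], this majorant is nonnegative, so the unfinished last epoch may be completed inside
   the sum. *)
pose B t := if phase_of d d' q t is Exploitation
            then C / (epoch_of d d' q t)%:R ^+ q else D.
have B0 t : 0 <= B t by rewrite /B; case: phase_of => // *; rewrite divr_ge0 ?exprn_ge0.
have bB t : (0 < t)%N -> b t <= B t.
  move=> t0; rewrite /B; case ht: (phase_of d d' q t); [exact: bD..|exact: bC].
have [A A0 hA] := epoch_of_powR.
exists (((d + d')%:R * D + C) * A) => T T0.
set k := epoch_of d d' q T.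
have [k0 /andP[_ Tk]] := epoch_ofP d d' q T0.
have sumB m : (0 < m)%N ->
    \sum_(j < d + d' + m ^ q) B (start m + j)%N <= (d + d')%:R * D + C.
  move=> m0; rewrite big_split_ord /= lerD //.
    apply: (@le_trans _ _ (\sum_(j < d + d') D)).
      apply: ler_sum => j _.
      have jb : (j < d + d' + m ^ q)%N by rewrite (leq_trans (ltn_ord j)) // leq_addr.
      rewrite /B; case hp: phase_of => //.
      have := @exploit_after d d' q (start m + j) isT hp.
      by rewrite epoch_of_add // leq_add2l leqNgt ltn_ord.
    by rewrite sumr_const card_ord mulr_natl.
  rewrite (eq_bigr (fun=> C / m%:R ^+ q)); last first.
    move=> j _; rewrite /B phase_of_exploit // epoch_of_add // ltn_add2l.
    exact: ltn_ord.
  rewrite sumr_const card_ord -[leLHS]mulr_natr natrX divfK //.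
  by rewrite expf_neq0 // pnatr_eq0 -lt0n.
have sum_le : \sum_(1 <= t < T.+1) b t <= ((d + d')%:R * D + C) * k%:R.
  apply: (@le_trans _ _ (\sum_(1 <= t < T.+1) B t)).
    by apply: ler_sum_nat => t /andP[t0 _]; apply: bB.
  apply: (@le_trans _ _ (\sum_(1 <= t < start k.+1) B t)).
    rewrite [leRHS](@big_cat_nat _ _ _ T.+1) //= lerDl sumr_ge0 // => *; exact: B0.
  rewrite sum_rounds.
  apply: (@le_trans _ _ (\sum_(1 <= m < k.+1) ((d + d')%:R * D + C))).
    by apply: ler_sum_nat => m /andP[m0 _]; apply: sumB.
  by rewrite sumr_const_nat subn1 mulr_natr.
apply: (@le_trans _ _ (((d + d')%:R * D + C) * (T%:R^-1 * k%:R))).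
  by rewrite mulrCA ler_wpM2l // invr_ge0.
rewrite -mulrA ler_wpM2l ?hA // addr_ge0 // mulr_ge0 //.
Qed.

End Average.

(** * Ridge regression *)

Section LinearAlgebra.
Context {R : realType}.

Lemma enorm_ge0 n (a : 'cV[R]_n) : 0 <= enorm a.
Proof. exact: sqrtr_ge0. Qed.

Lemma enorm_sqr n (a : 'cV[R]_n) : enorm a ^+ 2 = dot a a.
Proof.
rewrite /enorm sqr_sqrtr ?sumr_ge0 // => [|i _]; last exact: sqr_ge0.
by rewrite /dot mxE; apply: eq_bigr => i _; rewrite mxE expr2.
Qed.

Lemma dotE n (a b : 'cV[R]_n) : dot a b = \sum_i a i 0 * b i 0.
Proof. by rewrite /dot mxE; apply: eq_bigr => i _; rewrite mxE. Qed.

Lemma dotC n (a b : 'cV[R]_n) : dot a b = dot b a.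
Proof. by rewrite !dotE; apply: eq_bigr => i _; rewrite mulrC. Qed.

Lemma dotDr n (a b c : 'cV[R]_n) : dot a (b + c) = dot a b + dot a c.
Proof. by rewrite /dot mulmxDr mxE. Qed.

Lemma dotNr n (a b : 'cV[R]_n) : dot a (- b) = - dot a b.
Proof. by rewrite /dot mulmxN mxE. Qed.

Lemma dotZr n t (a b : 'cV[R]_n) : dot a (t *: b) = t * dot a b.
Proof. by rewrite /dot -scalemxAr mxE. Qed.

Lemma dot_sumr n (I : Type) (r : seq I) (P : pred I) (a : 'cV[R]_n) F :
  dot a (\sum_(i <- r | P i) F i) = \sum_(i <- r | P i) dot a (F i).
Proof. by rewrite /dot mulmx_sumr summxE. Qed.

Lemma dot_ge0 n (a : 'cV[R]_n) : 0 <= dot a a.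
Proof. by rewrite -enorm_sqr sqr_ge0. Qed.

Lemma dot_eq0 n (a : 'cV[R]_n) : dot a a = 0 -> a = 0.
Proof.
rewrite dotE => /eqP; rewrite psumr_eq0 => [|i _]; last by rewrite -expr2 sqr_ge0.
move=> /allP h; apply/colP => i; rewrite mxE.
by have := h i (mem_index_enum _); rewrite /= mulf_eq0 orbb => /eqP.
Qed.

Lemma outer_mul n (b u : 'cV[R]_n) : b *m b^T *m u = dot b u *: b.
Proof.
apply/colP => i; rewrite -mulmxA !mxE big_ord1 [RHS]mulrC; congr (_ * _).
Qed.

(** A singular matrix has the eigenvalue 0, which would force the infimum to be at most 0.
    Positivity also rules out the default value 0 of [inf], so the infimum is a genuine lower
    bound. *)
Lemma lambda_min_gt0_unit n (M : 'M[R]_n) : 0 < lambda_min M -> M \in unitmx.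
Proof.
rewrite /lambda_min => hM; rewrite -row_free_unit -kermx_eq0; apply/negPn/negP => nk.
have hinf : has_inf [set a | eigenvalue M a]%classic.
  by apply: contrapT => h; move: hM; rewrite inf_out // ltxx.
have e0 : eigenvalue M 0.
  rewrite /eigenvalue /eigenspace.
  have -> : M - 0%:M = M by apply/matrixP => i j; rewrite !mxE mul0rn subr0.
  exact: nk.
by have := ge_inf hinf.2 e0; rewrite leNgt hM.
Qed.


(** Cauchy-Schwarz, read off the nonnegative sum of the squares of N s_i - S, with N the cardinality
    and S the sum. *)
Lemma sum_sqr_ge (I : finType) (s : I -> R) :
  (\sum_i s i) ^+ 2 <= #|I|%:R * \sum_i s i ^+ 2.
Proof.
have [I0|I0] := posnP #|I|.
  by rewrite I0 mul0r big_pred0 ?expr0n // => i; have := fintype0 i I0.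
pose N : R := #|I|%:R; pose S := \sum_i s i.
have N0 : 0 < N by rewrite ltr0n.
have hN : \sum_i (N * s i - S) ^+ 2 = N * (N * (\sum_i s i ^+ 2) - S ^+ 2).
  transitivity (\sum_i (N ^+ 2 * s i ^+ 2 - (2 * N * S) * s i + S ^+ 2)).
    by apply: eq_bigr => i _; ring.
  rewrite big_split sumrB /= -!mulr_sumr sumr_const -/S -mulr_natl -/N; ring.
have : 0 <= \sum_i (N * s i - S) ^+ 2 by apply: sumr_ge0 => i _; apply: sqr_ge0.
by rewrite hN pmulr_rge0 // subr_ge0.
Qed.

(* For G = sum_i y_i y_i^T invertible, u = sum_i (y_i . u) G^-1 y_i, which
   bounds u by s = sum_i |y_i . u|.  Pairing the equation with u then bounds
   s^2 by a multiple of s. *)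
Lemma ridge_bound n (I : finType) (y : I -> 'cV[R]_n) :
  \sum_i y i *m (y i)^T \in unitmx ->
  exists2 C : R, 0 <= C & forall (m rho : I -> R) (u b : 'cV[R]_n) (c delta : R),
    0 < c -> 0 <= delta -> (forall i, c <= m i) -> (forall i, `|rho i| <= delta) ->
    u + \sum_i (m i * dot (y i) u) *: y i = \sum_i rho i *: y i - b ->
    enorm u <= C * (delta + \sum_j `|b j 0|) / c.
Proof.
set G := \sum_i _ => Gu.
pose a i := invmx G *m y i.
pose A : R := \sum_i \sum_j `|a i j 0|.
have A0 : 0 <= A by apply: sumr_ge0 => i _; apply: sumr_ge0.
(* Dominates both 1 and [A], so that delta + Y B <= Y (delta + B). *)
pose Y : R := 1 + A.
exists (n%:R * Y * #|I|%:R * Y); first by rewrite !mulr_ge0 // /Y; lra.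
move=> m rho u b c delta c0 d0 hm hrho hu.
pose sigma := \sum_i `|dot (y i) u|.
have s0 : 0 <= sigma by apply: sumr_ge0.
have u_le j : `|u j 0| <= A * sigma.
  have -> : u = \sum_i dot (y i) u *: a i.
    rewrite -[LHS](mulKmx Gu) /G mulmx_suml mulmx_sumr; apply: eq_bigr => i _.
    by rewrite outer_mul -scalemxAr.
  rewrite summxE (le_trans (ler_norm_sum _ _ _)) // mulr_sumr; apply: ler_sum => i _.
  rewrite mxE normrM mulrC ler_wpM2r // (le_trans _ (_ : \sum_j `|a i j 0| <= _)) //.
    by rewrite [leRHS](bigD1 j) //= lerDl sumr_ge0.
  by rewrite /A (bigD1 i) //= lerDl sumr_ge0 // => k _; apply: sumr_ge0.
have ssq : c * \sum_i dot (y i) u ^+ 2 <= (delta + Y * \sum_j `|b j 0|) * sigma.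
  have /(congr1 (dot u)) := hu.
  rewrite !dotDr dotNr !dot_sumr => hdot.
  have uu := dot_ge0 u.
  have h1 : c * \sum_i dot (y i) u ^+ 2 <= \sum_i dot u ((m i * dot (y i) u) *: y i).
    rewrite mulr_sumr; apply: ler_sum => i _.
    by rewrite dotZr [dot u _]dotC -mulrA -expr2 ler_wpM2r // sqr_ge0.
  have h2 : \sum_i dot u (rho i *: y i) <= delta * sigma.
    rewrite mulr_sumr; apply: ler_sum => i _.
    rewrite dotZr dotC (le_trans (ler_norm _)) // normrM ler_wpM2r //.
  have h3 : - dot u b <= Y * (\sum_j `|b j 0|) * sigma.
    rewrite (le_trans (ler_norm _)) // normrN dotE.
    rewrite (le_trans (ler_norm_sum _ _ _)) // mulrAC mulr_sumr; apply: ler_sum => j _.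
    rewrite normrM ler_wpM2r // (le_trans (u_le j)) // ler_wpM2r // /Y lerDr.
    exact: ler01.
  by rewrite mulrDl; lra.
set B := \sum_j `|b j 0| in ssq *.
have B0 : 0 <= B by apply: sumr_ge0.
have hdB : delta + Y * B <= Y * (delta + B) by rewrite mulrDr lerD2r ler_peMl // /Y lerDl.
(* Cauchy-Schwarz turns [ssq] into a bound of c sigma^2 by a multiple of sigma, and one factor sigma
   cancels unless it is 0. *)
have sig_le : sigma <= #|I|%:R * Y * (delta + B) / c.
  rewrite ler_pdivlMr //.
  have := sum_sqr_ge (fun i => `|dot (y i) u|); rewrite -/sigma.
  under [X in _ <= _ * X]eq_bigr do rewrite real_normK ?num_real //.
  move=> hcs; have [->|sig0] := eqVneq sigma 0.
    by rewrite mul0r !mulr_ge0 ?addr_ge0 // /Y; lra.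
  have sigp : 0 < sigma by rewrite lt_def sig0.
  rewrite -(ler_pM2r sigp) mulrAC -expr2 mulrC.
  apply: le_trans (ler_wpM2l (ltW c0) hcs) _.
  rewrite mulrCA -!mulrA ler_wpM2l // (le_trans ssq) // mulrA.
  by rewrite ler_wpM2r.
have enorm_le : enorm u <= n%:R * (A * sigma).
  have hh : 0 <= n%:R * (A * sigma) by rewrite !mulr_ge0.
  rewrite -(ler_pXn2r (n := 2)) ?nnegrE ?enorm_ge0 // enorm_sqr dotE.
  apply: (@le_trans _ _ (\sum_(i < n) (A * sigma) ^+ 2)).
    apply: ler_sum => i _; rewrite -expr2 -real_normK ?num_real //.
    by rewrite ler_pXn2r ?nnegrE ?mulr_ge0.
  rewrite sumr_const card_ord -[leLHS]mulr_natl; set Z := A * sigma.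
  rewrite [leRHS]exprMn ler_wpM2r ?sqr_ge0 //.
  by rewrite -natrX ler_nat; case: (n) => // n'; rewrite expnS leq_pmulr // expn_gt0.
apply: (le_trans enorm_le); rewrite -!mulrA ler_wpM2l //.
apply: ler_pM => //; first by rewrite /Y lerDr.
by rewrite !mulrA.
Qed.

End LinearAlgebra.

(** Applying the regularized Gram matrix to the error gives the accumulated noise minus [th], the
    bias caused by the identity matrix. This is the equation of [ridge_bound] with b = th. *)
Lemma ridge_error (R : realType) n (I : finType) (y : I -> 'cV[R]_n) :
  \sum_i y i *m (y i)^T \in unitmx ->
  exists2 C : R, 0 <= C & forall (m s : I -> R) (th : 'cV[R]_n) (c delta : R),
    0 < c -> 0 <= delta -> (forall i, c <= m i) ->
    (forall i, `|s i - m i * dot (y i) th| <= delta) ->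
    enorm (invmx (1%:M + \sum_i m i *: (y i *m (y i)^T)) *m (\sum_i s i *: y i) - th)
      <= C * (delta + \sum_j `|th j 0|) / c.
Proof.
move=> /ridge_bound[C C0 hC]; exists C => // m s th c delta c0 d0 hm hs.
set M := 1%:M + _.
have ME (u : 'cV[R]_n) : M *m u = u + \sum_i (m i * dot (y i) u) *: y i.
  rewrite mulmxDl mul1mx mulmx_suml; congr (_ + _); apply: eq_bigr => i _.
  by rewrite -scalemxAl outer_mul scalerA.
have Minj (u : 'cV[R]_n) : M *m u = 0 -> u = 0.
  rewrite ME => /(congr1 (dot u)); rewrite dotDr dot_sumr => hu.
  apply: dot_eq0; apply/eqP; rewrite eq_le dot_ge0 andbT.
  have <- : dot u 0 = 0 by rewrite /dot mulmx0 mxE.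
  rewrite -hu lerDl; apply: sumr_ge0 => i _.
  rewrite dotZr [dot u _]dotC -mulrA -expr2 mulr_ge0 ?sqr_ge0 //.
  exact: le_trans (ltW c0) (hm i).
(* [Minj] concerns columns and [kermx] rows, hence the transpositions. *)
have Mu : M \in unitmx.
  rewrite -unitmx_tr -row_free_unit -kermx_eq0.
  apply/eqP/row_matrixP => i; rewrite row0; apply: trmx_inj; rewrite trmx0.
  apply: Minj; apply: trmx_inj.
  by rewrite trmx_mul trmxK -row_mul mulmx_ker row0 trmx0.
apply: (hC m (fun i => s i - m i * dot (y i) th)) => //.
rewrite -ME mulmxBr mulKVmx // ME.
rewrite opprD addrA addrAC; congr (_ - _); rewrite -sumrB.
by apply: eq_bigr => i _; rewrite scalerBl.
Qed.

(** * The estimators regrouped by exploration edge and node *)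

Section Estimators.
Context {R : realType} {V : finType} {d d' : nat}.
Variables (x : V * V -> 'cV[R]_d) (xm : V -> 'cV[R]_d').
Variables (q : nat) (edg : 'I_d -> V * V) (vauto : 'I_d' -> V).
Variables (h : seq (@outcome V)) (k : nat).

Definition edge_rounds (i : 'I_d) :=
  [seq @edge_round d d' q m i | m <- index_iota 1 k.+1].

Definition auton_rounds (i : 'I_d') :=
  [seq @auton_round d d' q m i | m <- index_iota 1 k.+1].

Definition activated (v : V) (o : @outcome V) : R := (act_step o v == Some 1%N)%:R.

Lemma theta_hatE : theta_hat (d' := d') x q edg h k =
  invmx (1%:M + \sum_i k%:R *: (x (edg i) *m (x (edg i))^T)) *m
  \sum_i (\sum_(t <- edge_rounds i) activated (edg i).2 (round h t)) *: x (edg i).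
Proof.
congr (invmx (_ + _) *m _).
  by rewrite sumr_const_nat subn1 -scaler_sumr scaler_nat.
rewrite /edge_response exchange_big /=; apply: eq_bigr => i _.
by rewrite big_map scaler_suml.
Qed.

(** In contrast with the fixed weight [k] of the edges, the weight of a node is its random number of
    recorded samples. *)
Lemma beta_hatE : beta_hat (d := d) xm q vauto h k =
  invmx (1%:M + \sum_i (\sum_(t <- auton_rounds i) activated (vauto i) (round h t)) *:
           (xm (vauto i) *m (xm (vauto i))^T)) *m
  \sum_i (\sum_(t <- auton_rounds i) activated (vauto i) (round h t) *
            (1 - (positive (round h t) (vauto i))%:R)) *: xm (vauto i).
Proof.
congr (invmx (_ + _) *m _).
  under eq_bigr do rewrite big_mkcond.
  rewrite exchange_big /=; apply: eq_bigr => i _.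
  rewrite big_map scaler_suml; apply: eq_bigr => m _.
  by rewrite /activated /recorded; case: eqP; rewrite ?scale1r ?scale0r.
rewrite /auton_response; under eq_bigr do rewrite big_mkcond.
rewrite exchange_big /=; apply: eq_bigr => i _.
rewrite big_map scaler_suml; apply: eq_bigr => m _.
by rewrite /activated /recorded; case: eqP; rewrite ?mul1r ?mul0r ?scale0r.
Qed.

End Estimators.

(** * Elementary bounds for the choice of constants *)

Lemma small_multiple (R : realType) (a e : R) : 0 <= a -> 0 < e ->
  exists2 b : R, 0 < b & forall t, 0 <= t <= b -> a * t <= e.
Proof.
move=> a0 e0; have a1 : 0 < a + 1 by lra.
exists (e / (a + 1)); first by rewrite divr_gt0.
move=> t /andP[t0 tb]; apply: (@le_trans _ _ ((a + 1) * t)); first by nra.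
by move: tb; rewrite ler_pdivlMr // mulrC.
Qed.

Lemma large_divisor (R : realType) (a e : R) : 0 < e ->
  exists k0, forall k, (k0 <= k)%N -> a <= e * k%:R.
Proof.
move=> e0; exists (Num.truncn (a / e)).+1 => k hk.
have : a / e <= k%:R.
  by apply: le_trans (ltW (truncnS_gt _)) _; rewrite ler_nat.
by rewrite ler_pdivrMr // mulrC.
Qed.

Lemma positive_lower_bound (R : realType) (I : finType) (p : I -> R) :
  (forall i, 0 < p i) -> exists2 P : R, 0 < P & forall i, P <= p i.
Proof.
move=> hp; exists (\big[Num.min/1]_i p i); first exact: lt_bigmin.
by move=> i; apply: bigmin_le_cond.
Qed.

(** The inequality y <= exp(y) at y = c k / q, raised to the power q and inverted. *)
Lemma expR_le_power (R : realType) (q : nat) (c : R) (k : nat) :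
  (0 < q)%N -> 0 < c -> (0 < k)%N ->
  expR (- (c * k%:R)) <= (q%:R / c) ^+ q / k%:R ^+ q.
Proof.
move=> q0 c0 k0; have qR : 0 < (q%:R : R) by rewrite ltr0n.
have kR : 0 < (k%:R : R) by rewrite ltr0n.
have hy : 0 < c * k%:R / q%:R by rewrite !mulr_gt0 ?invr_gt0.
rewrite expRN -expr_div_n.
have -> : q%:R / c / k%:R = (c * k%:R / q%:R)^-1.
  by field; rewrite !gt_eqF.
rewrite exprVn lef_pV2 ?posrE ?expR_gt0 ?exprn_gt0 //.
have -> : expR (c * k%:R) = expR (c * k%:R / q%:R) ^+ q.
  by rewrite -expRM_natr divfK // gt_eqF.
rewrite lerXn2r ?nnegrE ?expR_ge0 ?(ltW hy) //.
by apply: le_trans (expR_ge1Dx _); rewrite lerDr.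
Qed.

(** * Regret *)

Section Regret.
Variables (R : realType) (V : finType) (E : {set V * V}) (d d' K q : nat).
Variables (x : V * V -> 'cV[R]_d) (xp xm : V -> 'cV[R]_d').
Variables (theta_star : 'cV[R]_d) (beta_star : 'cV[R]_d').
Variable fext : (V * V -> R) -> (V -> R) -> (V -> R) -> {set V} -> R.
Variable oracle : (V * V -> R) -> (V -> R) -> (V -> R) -> {set V} -> R.
Variables (edg : 'I_d -> V * V) (vauto : 'I_d' -> V).
Variables (alpha gamma : R).

Notation w := (edge_weight x theta_star).
Notation qp := (auton xp beta_star).
Notation qm := (auton xm beta_star).
Notation alg := (explore_exploit E x xp xm K q edg vauto oracle).
Notation prob := (outcome_prob E w qp qm).
Notation opt := (fopt E fext K w qp qm).
Notation regret := (scaled_regret E fext K w qp qm (alpha * gamma)).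
Notation outcome := (@outcome V).

Hypothesis hE : loopless E.
Hypothesis q0 : (0 < q)%N.
Hypothesis hw01 : forall e, e \in E -> 0 <= w e <= 1.
Hypothesis hwsum : forall v, in_weight E w [set: V] v <= 1.
Hypothesis hedgE : forall i, edg i \in E.
Hypothesis hqp : forall v, 0 <= qp v.
Hypothesis hqm : forall v, 0 <= qm v.
Hypothesis hqsum : forall v, qp v + qm v <= 1.
Hypothesis edge_unit : \sum_i x (edg i) *m (x (edg i))^T \in unitmx.
Hypothesis auton_unit : \sum_i xm (vauto i) *m (xm (vauto i))^T \in unitmx.
Hypothesis hactivable : forall i,
  0 < in_weight E w (chosen_parents E K (vauto i)) (vauto i).
Hypothesis alpha0 : 0 < alpha.
Hypothesis gamma0 : 0 < gamma.
Hypothesis horacle : is_oracle E fext K alpha gamma oracle.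

Lemma fplus_star_ge0 S : 0 <= fplus E fext w qp qm S.
Proof.
rewrite /fplus.
have -> : admissible_weights E w.
  apply/andP; split; last exact/forallP.
  by apply/forallP => e; apply/implyP; apply: hw01.
have -> : admissible_autonomy qp qm.
  by apply/forallP => v; rewrite hqp hqm hqsum.
by apply: sumr_ge0 => o _; rewrite mulr_ge0 // outcome_prob_ge0.
Qed.

Lemma fopt_star_ge0 : 0 <= opt.
Proof. exact: le_trans (fplus_star_ge0 _) (bigmax_ge_id _ _ _ _). Qed.

Lemma point_mass_pmf (T : finType) (a : T) : is_pmf (point_mass a : T -> R).
Proof.
split=> [b|]; first exact: ler0n.
by rewrite (bigD1 a) //= big1 /point_mass ?eqxx ?addr0 // => b /negbTE ->.
Qed.

Lemma explore_exploit_pmf h : is_pmf (alg h).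
Proof.
rewrite /explore_exploit; case: phase_of => *; try exact: point_mass_pmf.
by case: (horacle (edge_weight x (theta_hat (d' := d') x q edg h
  (epoch_of d d' q (size h).+1))) (auton xp (beta_hat (d := d) xm q vauto h
  (epoch_of d d' q (size h).+1))) (auton xm (beta_hat (d := d) xm q vauto h
  (epoch_of d d' q (size h).+1)))).
Qed.

Lemma regret_le_fopt S : regret S <= opt.
Proof.
rewrite /scaled_regret gerBl mulr_ge0 ?fplus_star_ge0 // invr_ge0.
by rewrite mulr_ge0 ?ltW.
Qed.

Lemma mean_regret_le_fopt p : is_pmf p -> \sum_S p S * regret S <= opt.
Proof.
move=> [p0 p1]; rewrite -[leRHS]mul1r -p1 mulr_suml.
by apply: ler_sum => S _; rewrite ler_wpM2l ?regret_le_fopt.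
Qed.

(** The oracle's guarantee holds at the parameters it is given; [hgood] transfers it to the true
    ones. The mean spread is then at least gamma alpha times the optimum, since sets outside the
    good family contribute nonnegatively. *)
Lemma oracle_regret_le0 theta beta :
  good_sets E x xp xm fext K alpha theta beta =
    good_sets E x xp xm fext K alpha theta_star beta_star ->
  \sum_S oracle (edge_weight x theta) (auton xp beta) (auton xm beta) S
    * regret S <= 0.
Proof.
move=> hgood.
have [[p0 p1] _ hp] := horacle (edge_weight x theta) (auton xp beta) (auton xm beta).
set p := oracle _ _ _ in p0 p1 hp *.
have ag0 : 0 < alpha * gamma by rewrite mulr_gt0.
rewrite /scaled_regret; under eq_bigr do rewrite mulrBr mulrCA.
rewrite sumrB -mulr_suml p1 mul1r -mulr_sumr subr_le0 mulrC ler_pdivlMr //.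
apply: (@le_trans _ _ (\sum_(S in good_sets E x xp xm fext K alpha theta_star beta_star)
    p S * (alpha * opt))).
  rewrite -mulr_suml (_ : opt * _ = gamma * (alpha * opt)); last by ring.
  rewrite ler_wpM2r ?(mulr_ge0 (ltW alpha0) fopt_star_ge0) // -hgood.
  apply: (le_trans hp); rewrite le_eqVlt; apply/orP; left; apply/eqP.
  by apply: eq_bigl => S; rewrite inE.
rewrite [leRHS](bigID (mem (good_sets E x xp xm fext K alpha theta_star beta_star))) /=.
rewrite -[leLHS]addr0 lerD //; last first.
  by apply: sumr_ge0 => S _; rewrite mulr_ge0 // fplus_star_ge0.
by apply: ler_sum => S; rewrite inE => hS; rewrite ler_wpM2l.
Qed.

Lemma edge_round_gt0 m i : (0 < @edge_round d d' q m i)%N.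
Proof. by rewrite /edge_round /epoch_start. Qed.

Lemma auton_round_gt0 m i : (0 < @auton_round d d' q m i)%N.
Proof. by rewrite /auton_round /epoch_start. Qed.

Lemma explore_edge k i t h : t \in edge_rounds (d' := d') q k i ->
  size h = t.-1 -> alg h = point_mass [set (edg i).1].
Proof.
case/mapP=> m; rewrite mem_index_iota => /andP[m0 _] -> hs.
by rewrite /explore_exploit hs prednK ?edge_round_gt0 // phase_of_edge.
Qed.

Lemma explore_auton k i t h : t \in auton_rounds (d := d) q k i ->
  size h = t.-1 -> alg h = point_mass (chosen_parents E K (vauto i)).
Proof.
case/mapP=> m; rewrite mem_index_iota => /andP[m0 _] -> hs.
by rewrite /explore_exploit hs prednK ?auton_round_gt0 // phase_of_auton.
Qed.

Lemma edge_rounds_uniq k i : uniq (edge_rounds (d := d) (d' := d') q k i).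
Proof.
rewrite map_inj_in_uniq ?iota_uniq // => m j.
rewrite !mem_index_iota => /andP[m0 _] /andP[j0 _].
exact: edge_round_inj.
Qed.

Lemma auton_rounds_uniq k i : uniq (auton_rounds (d := d) (d' := d') q k i).
Proof.
rewrite map_inj_in_uniq ?iota_uniq // => m j.
rewrite !mem_index_iota => /andP[m0 _] /andP[j0 _].
exact: auton_round_inj.
Qed.

Lemma mem_edge_rounds k i t s : t \in edge_rounds (d := d) (d' := d') q k i ->
  (epoch_start d d' q k + (d + d') <= s)%N -> (0 < t < s)%N.
Proof.
case/mapP=> m; rewrite mem_index_iota ltnS => /andP[m0 mk] -> hs.
rewrite edge_round_gt0 /= (leq_trans _ hs) // /edge_round.
have := @epoch_start_le d d' q m k; rewrite m0 mk => /(_ isT).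
by have := ltn_ord i; lia.
Qed.

Lemma mem_auton_rounds k i t s : t \in auton_rounds (d := d) (d' := d') q k i ->
  (epoch_start d d' q k + (d + d') <= s)%N -> (0 < t < s)%N.
Proof.
case/mapP=> m; rewrite mem_index_iota ltnS => /andP[m0 mk] -> hs.
rewrite auton_round_gt0 /= (leq_trans _ hs) // /auton_round.
have := @epoch_start_le d d' q m k; rewrite m0 mk => /(_ isT).
by have := ltn_ord i; lia.
Qed.

Lemma edge_notin i : (edg i).2 \notin [set (edg i).1].
Proof.
rewrite inE; apply: contraNneq (hE (edg i).1) => e.
by have := hedgE i; rewrite [edg i]surjective_pairing e.
Qed.

Lemma chosen_parents_sub v : chosen_parents E K v \subset in_nbrs E v.
Proof.
by apply/fintype.subsetP => u; rewrite inE => /mem_take; rewrite mem_enum.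
Qed.

Lemma parents_notin v : v \notin chosen_parents E K v.
Proof.
apply/negP => /(fintype.subsetP (chosen_parents_sub v)).
by rewrite inE (negbTE (hE v)).
Qed.

Lemma in_weight_edge i : in_weight E w [set (edg i).1] (edg i).2 = w (edg i).
Proof.
rewrite /in_weight (_ : _ :&: _ = [set (edg i).1]) ?big_set1 -?surjective_pairing //.
apply/setP => u; rewrite !inE; case: eqP => [->|]; rewrite ?andbF //.
by rewrite -surjective_pairing hedgE.
Qed.

Lemma activated_centred (S : {set V}) v : v \notin S ->
  \sum_o prob S o * (activated (R := R) v o - in_weight E w S v) = 0.
Proof.
move=> vS; under eq_bigr do rewrite mulrBr.
rewrite sumrB -mulr_suml outcome_prob_sum1 mul1r.
by rewrite activation_prob // subrr.
Qed.

Lemma activated_centred_le1 (S : {set V}) v o :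
  `|activated (R := R) v o - in_weight E w S v| <= 1.
Proof.
have h0 := in_weight_ge0 hw01 S v; have h1 := in_weight_le1 hw01 hwsum S v.
by rewrite /activated ler_norml; case: eqP => _ /=; lra.
Qed.

(** The regression noise of one autonomy round. It is 0 when nothing is recorded, so its sum over
    all rounds of a node has a deterministic number of terms. *)
Definition neg_residual v (o : outcome) : R :=
  activated v o * (1 - (positive o v)%:R - qm v).

Lemma neg_residual_le1 v o : `|neg_residual v o| <= 1.
Proof.
have h0 := hqm v; have h1 : qm v <= 1 by have := hqsum v; have := hqp v; lra.
rewrite /neg_residual /activated ler_norml.
by case: eqP => _ /=; case: positive => /=; lra.
Qed.


Lemma size_edge_rounds k i : size (edge_rounds (d := d) (d' := d') q k i) = k.
Proof. by rewrite size_map size_iota subn1. Qed.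

Lemma size_auton_rounds k i : size (auton_rounds (d := d) (d' := d') q k i) = k.
Proof. by rewrite size_map size_iota subn1. Qed.

Lemma sum_const_size (T : Type) (r : seq T) (a : R) : \sum_(t <- r) a = (size r)%:R * a.
Proof. by rewrite big_const_seq count_predT iter_addr_0 mulr_natl. Qed.

Notation edge_sum h k i :=
  (\sum_(t <- edge_rounds (d' := d') q k i)
     (activated (edg i).2 (round h t) - in_weight E w [set (edg i).1] (edg i).2)).
Notation auton_sum h k i :=
  (\sum_(t <- auton_rounds (d := d) q k i)
     (activated (vauto i) (round h t)
      - in_weight E w (chosen_parents E K (vauto i)) (vauto i))).
Notation sign_sum h k i :=
  (\sum_(t <- auton_rounds (d := d) q k i) neg_residual (vauto i) (round h t)).

Lemma estimates_close etheta ebeta : 0 < etheta -> 0 < ebeta ->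
  exists (delta : R) (k0 : nat), 0 < delta <= 1 /\ forall (k : nat) h,
    (k0 <= k)%N -> (0 < k)%N ->
    (forall i, `|edge_sum h k i| < delta * k%:R) ->
    (forall i, `|auton_sum h k i| < delta * k%:R) ->
    (forall i, `|sign_sum h k i| < delta * k%:R) ->
    enorm (theta_hat (d' := d') x q edg h k - theta_star) <= etheta /\
    enorm (beta_hat (d := d) xm q vauto h k - beta_star) <= ebeta.
Proof.
move=> et0 eb0.
have [C1 C10 H1] := ridge_error edge_unit.
have [C2 C20 H2] := ridge_error auton_unit.
(* Half of the activation probability is given up to fluctuation: a node is recorded at least 2 P k
   - delta k >= P k times. *)
have [P P0 hP] := @positive_lower_bound R 'I_d' (fun i =>
  in_weight E w (chosen_parents E K (vauto i)) (vauto i) / 2)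
  (fun i => divr_gt0 (hactivable i) (ltr0n R 2)).
(* Each error budget is split in two: a small [delta] controls the noise, a large [k] the ridge
   bias. *)
have [b1 b10 hb1] := small_multiple C10 (divr_gt0 et0 (ltr0n R 2)).
have [b2 b20 hb2] := small_multiple C20 (divr_gt0 (mulr_gt0 eb0 P0) (ltr0n R 2)).
have [k1 hk1] := large_divisor (C1 * \sum_j `|theta_star j 0|) (divr_gt0 et0 (ltr0n R 2)).
have [k2 hk2] := large_divisor (C2 * \sum_j `|beta_star j 0|)
  (divr_gt0 (mulr_gt0 eb0 P0) (ltr0n R 2)).
pose delta := Num.min (Num.min 1 P) (Num.min b1 b2).
have d0 : 0 < delta by rewrite !lt_min ltr01 P0 b10 b20.
have d1 : delta <= 1 by rewrite !ge_min lexx.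
have dP : delta <= P by rewrite !ge_min lexx orbT.
have db1 : delta <= b1 by rewrite !ge_min lexx !orbT.
have db2 : delta <= b2 by rewrite !ge_min lexx !orbT.
exists delta, (maxn k1 k2); split; first by rewrite d0 d1.
move=> k h; rewrite geq_max => /andP[/hk1 {}hk1 /hk2 {}hk2] kpos hsE hsA hsS.
have kR : 0 < (k%:R : R) by rewrite ltr0n.
split.
- rewrite theta_hatE.
  apply: le_trans (H1 _ _ theta_star k%:R (delta * k%:R) _ _ _ _) _ => //.
  + by rewrite mulr_ge0 ?ltW.
  + move=> i; have := ltW (hsE i).
    by rewrite sumrB sum_const_size size_edge_rounds in_weight_edge.
  rewrite ler_pdivrMr //.
  have : C1 * delta * k%:R <= etheta / 2 * k%:R.
    by rewrite ler_wpM2r ?(ltW kR) // hb1 // (ltW d0).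
  lra.
- rewrite beta_hatE.
  apply: le_trans (H2 _ _ beta_star (P * k%:R) (delta * k%:R) _ _ _ _) _ => //.
  + by rewrite mulr_gt0.
  + by rewrite mulr_ge0 ?ltW.
  + move=> i; have := hsA i.
    rewrite sumrB sum_const_size size_auton_rounds ltr_norml => /andP[hlow _].
    have := ler_wpM2l (ltW kR) (hP i); have := ler_wpM2r (ltW kR) dP.
    lra.
  + move=> i; have := ltW (hsS i).
    rewrite /neg_residual mulr_suml -sumrB.
    by under eq_bigr do rewrite mulrBr.
  rewrite ler_pdivrMr ?mulr_gt0 //.
  have : C2 * delta * k%:R <= ebeta * P / 2 * k%:R.
    by rewrite ler_wpM2r ?(ltW kR) // hb2 // (ltW d0).
  lra.
Qed.

Lemma neg_residual_centred i :
  \sum_o prob (chosen_parents E K (vauto i)) o * neg_residual (vauto i) o = 0.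
Proof. by apply: sign_residual; rewrite ?parents_notin ?hactivable. Qed.

Lemma seed_mean_regret_le t : seed_mean E alg w qp qm t regret <= opt.
Proof.
have pge0 := outcome_prob_ge0 hw01 hqp hqm hqsum.
have psum := outcome_prob_sum1 E w qp qm.
rewrite /seed_mean -[leRHS](history_mean_cst pge0 psum explore_exploit_pmf t.-1).
apply: (history_mean_le pge0 explore_exploit_pmf) => h _.
exact/mean_regret_le_fopt/explore_exploit_pmf.
Qed.

Variables etheta ebeta : R.
Hypothesis etheta0 : 0 < etheta.
Hypothesis ebeta0 : 0 < ebeta.
Hypothesis stable_good_sets : forall theta beta,
  enorm (theta - theta_star) <= etheta -> enorm (beta - beta_star) <= ebeta ->
  good_sets E x xp xm fext K alpha theta beta =
  good_sets E x xp xm fext K alpha theta_star beta_star.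

Lemma exploitation_regret : exists2 C : R, 0 <= C & forall t, (0 < t)%N ->
  phase_of d d' q t = Exploitation ->
  seed_mean E alg w qp qm t regret <= C / (epoch_of d d' q t)%:R ^+ q.
Proof.
have pge0 := outcome_prob_ge0 hw01 hqp hqm hqsum.
have psum := outcome_prob_sum1 E w qp qm.
have [delta [k0 [hdelta hclose]]] := estimates_close etheta0 ebeta0.
have [d0 d1] := andP hdelta.
have opt0 := fopt_star_ge0.
pose c := delta ^+ 2 / 8.
have c0 : 0 < c by rewrite divr_gt0 // exprn_gt0.
(* The number of statistics: one per edge, two per autonomy node. *)
pose N : R := d%:R + 2 * d'%:R.
have N0 : 0 <= N by rewrite addr_ge0 // mulr_ge0.
pose A : R := (q%:R / c) ^+ q.
have A0 : 0 <= A by rewrite exprn_ge0 // divr_ge0 // ltW.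
(* The first term serves the epochs before [k0], where only the trivial bound [opt] is available;
   the second adds up the two-sided tails. *)
exists (opt * k0%:R ^+ q + opt * (N * (2 * A))).
  by apply: addr_ge0; apply: mulr_ge0 => //; rewrite ?exprn_ge0 ?ler0n // mulr_ge0 // mulr_ge0.
move=> t t0 ht; set k := epoch_of d d' q t.
have [kpos _] := epoch_ofP d d' q t0; rewrite -/k in kpos.
have kR : 0 < (k%:R : R) ^+ q by rewrite exprn_gt0 // ltr0n.
have [kk0|k0k] := ltnP k k0.
  apply: le_trans (seed_mean_regret_le t) _; rewrite ler_pdivlMr //.
  rewrite -[leLHS]addr0 lerD ?mulr_ge0 // ler_wpM2l //.
  by rewrite lerXn2r ?nnegrE // ler_nat ltnW.
have hstart := exploit_after t0 ht; rewrite -/k in hstart.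
pose big (s : R) : R := (delta * k%:R <= `|s|)%R%:R.
(* Below 1, bad h vanishes and the estimates are close; otherwise it dominates
   the indicator of the bad event. *)
pose bad h := \sum_i big (edge_sum h k i) +
  \sum_i (big (auton_sum h k i) + big (sign_sum h k i)).
have big0 s : 0 <= big s by exact: ler0n.
have small s : big s < 1 -> `|s| < delta * k%:R.
  by rewrite /big; case: (lerP (delta * k%:R)) => //= _; rewrite ltxx.
have bad_regret h : size h = t.-1 -> \sum_S alg h S * regret S <= opt * bad h.
  move=> hs; have sumE0 : 0 <= \sum_i big (edge_sum h k i) by exact: sumr_ge0.
  have sumA0 : 0 <= \sum_i (big (auton_sum h k i) + big (sign_sum h k i)).
    by apply: sumr_ge0 => i _; rewrite addr_ge0.
  have [bad1|bad1] := leP 1 (bad h).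
    apply: le_trans (mean_regret_le_fopt (explore_exploit_pmf h)) _.
    by rewrite ler_peMr.
  have auton_le i : big (auton_sum h k i) + big (sign_sum h k i) <= bad h.
    apply: le_trans (_ : _ <= \sum_i (big (auton_sum h k i) + big (sign_sum h k i))) _.
      by rewrite (bigD1 i) //= lerDl sumr_ge0 // => j _; rewrite addr_ge0.
    by rewrite lerDr.
  have [cE cB] : enorm (theta_hat (d' := d') x q edg h k - theta_star) <= etheta /\
      enorm (beta_hat (d := d) xm q vauto h k - beta_star) <= ebeta.
    apply: hclose => // i; apply: small; apply: le_lt_trans bad1; rewrite /bad.
    - apply: (@le_trans _ _ (\sum_i big (edge_sum h k i))); last by rewrite lerDl.
      by rewrite (bigD1 i) //= lerDl sumr_ge0.
    - apply: (@le_trans _ _ (big (auton_sum h k i) + big (sign_sum h k i))).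
        by rewrite lerDl.
      exact: auton_le.
    - apply: (@le_trans _ _ (big (auton_sum h k i) + big (sign_sum h k i))).
        by rewrite lerDr.
      exact: auton_le.
  have -> : alg h = oracle (edge_weight x (theta_hat (d' := d') x q edg h k))
      (auton xp (beta_hat (d := d) xm q vauto h k))
      (auton xm (beta_hat (d := d) xm q vauto h k)).
    by rewrite /explore_exploit hs prednK // ht.
  apply: le_trans (oracle_regret_le0 (stable_good_sets cE cB)) _.
  by rewrite mulr_ge0 // addr_ge0.
have tail r S0 (g : outcome -> R) : size r = k -> uniq r ->
    (forall s, s \in r -> (0 < s < t)%N) ->
    (forall s h, s \in r -> size h = s.-1 -> alg h = point_mass S0) ->
    \sum_o prob S0 o * g o = 0 -> (forall o, `|g o| <= 1) ->
    history_mean E alg w qp qm t.-1 (fun h => big (\sum_(s <- r) g (round h s)))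
    <= 2 * A / k%:R ^+ q.
  move=> sr ur hr seed g0 g1.
  have := @history_tail R V E w qp qm pge0 psum alg explore_exploit_pmf r S0 g t.-1
    delta ur _ seed g0 g1 hdelta.
  rewrite sr -/c => htail; apply: le_trans (htail _) _.
    by move=> s /hr /andP[-> st]; rewrite -ltnS prednK.
  by rewrite -mulrA ler_wpM2l // expR_le_power.
have tailE i := tail _ [set (edg i).1]
  (fun o => activated (edg i).2 o - in_weight E w [set (edg i).1] (edg i).2)
  (size_edge_rounds k i) (edge_rounds_uniq k i)
  (fun s hs => mem_edge_rounds hs hstart) (@explore_edge k i)
  (activated_centred (edge_notin i)) (activated_centred_le1 _ _).
have tailA i := tail _ (chosen_parents E K (vauto i))
  (fun o => activated (vauto i) o -
     in_weight E w (chosen_parents E K (vauto i)) (vauto i))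
  (size_auton_rounds k i) (auton_rounds_uniq k i)
  (fun s hs => mem_auton_rounds hs hstart) (@explore_auton k i)
  (activated_centred (parents_notin _)) (activated_centred_le1 _ _).
have tailS i := tail _ (chosen_parents E K (vauto i)) (neg_residual (vauto i))
  (size_auton_rounds k i) (auton_rounds_uniq k i)
  (fun s hs => mem_auton_rounds hs hstart) (@explore_auton k i)
  (neg_residual_centred i) (neg_residual_le1 _).
(* Taking the mean of the sum of indicators [bad] plays the role of a union bound. *)
apply: le_trans (history_mean_le pge0 explore_exploit_pmf bad_regret) _.
rewrite (history_meanZ pge0 explore_exploit_pmf) mulrDl.
apply: (@le_trans _ _ (opt * (N * (2 * A)) / k%:R ^+ q)); last first.
  by rewrite lerDr divr_ge0 ?mulr_ge0 ?exprn_ge0 // ltW.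
rewrite -mulrA ler_wpM2l // -[N * _ * _]mulrA.
rewrite (history_meanD pge0 explore_exploit_pmf).
rewrite !(history_mean_sum pge0 psum explore_exploit_pmf).
under [X in _ + X]eq_bigr do rewrite (history_meanD pge0 explore_exploit_pmf).
have -> : N * (2 * A / k%:R ^+ q) =
    d%:R * (2 * A / k%:R ^+ q) + d'%:R * (2 * A / k%:R ^+ q + 2 * A / k%:R ^+ q).
  by rewrite /N; ring.
apply: lerD.
  apply: (le_trans (ler_sum _ (fun i _ => tailE i))).
  by rewrite sumr_const card_ord [leRHS]mulr_natl.
apply: (le_trans (ler_sum _ (fun i _ => lerD (tailA i) (tailS i)))).
by rewrite sumr_const card_ord [leRHS]mulr_natl.
Qed.

Lemma regret_rate : exists A : R, forall T, (0 < T)%N ->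
  T%:R^-1 * \sum_(1 <= t < T.+1) seed_mean E alg w qp qm t regret
  <= A * T%:R `^ (- (q%:R / q.+1%:R)).
Proof.
have [C C0 hC] := exploitation_regret.
apply: (epoch_average fopt_star_ge0 C0 _ hC) => t _.
exact: seed_mean_regret_le.
Qed.

End Regret.
Theorem proposition2 (R : realType) (V : finType) (E : {set V * V})
  (d d' K q : nat)
  (x : V * V -> 'cV[R]_d) (xp xm : V -> 'cV[R]_d')
  (theta_star : 'cV[R]_d) (beta_star : 'cV[R]_d')
  (fext : (V * V -> R) -> (V -> R) -> (V -> R) -> {set V} -> R)
  (oracle : (V * V -> R) -> (V -> R) -> (V -> R) -> {set V} -> R)
  (edg : 'I_d -> V * V) (vauto : 'I_d' -> V)
  (D Dbeta eps0 alpha gamma : R)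
  (hE : loopless E)
  (hq : (0 < q)%N)
  (* (B1) *)
  (hD : enorm theta_star <= D)
  (hw01 : forall e, e \in E -> 0 <= edge_weight x theta_star e <= 1)
  (hwsum : forall v,
     \sum_(u in in_nbrs E v) edge_weight x theta_star (u, v) <= 1)
  (* (B2) *)
  (hB2 : forall v (B : {set V}), B \subset in_nbrs E v ->
     enorm (\sum_(u in B) x (u, v)) <= 1)
  (* (B3) *)
  (hedgE : forall i, edg i \in E)
  (hB3 : 0 < lambda_min (\sum_(i < d) x (edg i) *m (x (edg i))^T))
  (* (B4) *)
  (hDbeta : enorm beta_star <= Dbeta)
  (hqp : forall v, 0 <= auton xp beta_star v)
  (hqm : forall v, 0 <= auton xm beta_star v)
  (hqsum : forall v, auton xp beta_star v + auton xm beta_star v <= 1)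
  (* (B5) *)
  (hparent : forall i, in_nbrs E (vauto i) != finset.set0)
  (hB5 : 0 < lambda_min (\sum_(i < d') xm (vauto i) *m (xm (vauto i))^T))
  (* the chosen parents of vauto i can activate it *)
  (hactivable : forall i,
     0 < \sum_(u in chosen_parents E K (vauto i))
           edge_weight x theta_star (u, vauto i))
  (* (B6) *)
  (heps0 : 0 < eps0)
  (halpha : alpha = 1 - (expR 1)^-1 - eps0)
  (halpha0 : 0 < alpha)
  (hgamma : 0 < gamma <= 1)
  (horacle : is_oracle E fext K alpha gamma oracle)
  (* (B7) *)
  (hB7 : exists eps_theta eps_beta : R,
     [/\ 0 < eps_theta, 0 < eps_beta,
         forall theta beta,
           enorm (theta - theta_star) <= eps_theta ->
           enorm (beta - beta_star) <= eps_beta ->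
           good_sets E x xp xm fext K alpha theta beta
           = good_sets E x xp xm fext K alpha theta_star beta_star
       & exists SA : {set V}, forall theta beta,
           enorm (theta - theta_star) <= eps_theta ->
           enorm (beta - beta_star) <= eps_beta ->
           SA \in good_sets E x xp xm fext K alpha theta beta /\
           (forall S, S \in good_sets E x xp xm fext K alpha theta beta ->
              f_lin E x xp xm fext theta beta SA
              <= f_lin E x xp xm fext theta beta S)]) :
  let w := edge_weight x theta_star in
  let qp := auton xp beta_star in
  let qm := auton xm beta_star in
  let alg := explore_exploit E x xp xm K q edg vauto oracle in
  exists (C : R) (T0 : nat), forall T : nat, (T0 <= T)%N ->
    T%:R^-1 * \sum_(1 <= t < T.+1)
       seed_mean E alg w qp qm t
         (scaled_regret E fext K w qp qm (alpha * gamma))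
    <= C * T%:R `^ (- (q%:R / q.+1%:R)).
Proof.
have [gamma0 _] := andP hgamma.
have [etheta [ebeta [etheta0 ebeta0 stable _]]] := hB7.
(* [in_weight] intersects with the in-neighbours, whereas the hypotheses sum over sets that already
   consist of them. *)
have in_weightE (A : {set V}) v : A \subset in_nbrs E v ->
    in_weight E (edge_weight x theta_star) A v =
    \sum_(u in A) edge_weight x theta_star (u, v).
  by move=> sA; rewrite /in_weight (finset.setIidPr sA).
have hsum v : in_weight E (edge_weight x theta_star) [set: V] v <= 1.
  by rewrite /in_weight finset.setIT.
have hact i : 0 < in_weight E (edge_weight x theta_star)
    (chosen_parents E K (vauto i)) (vauto i).
  by rewrite in_weightE ?chosen_parents_sub.
have [A hA] := regret_rate hE hq hw01 hsum hedgE hqp hqm hqsum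
  (lambda_min_gt0_unit hB3) (lambda_min_gt0_unit hB5) hact halpha0 gamma0
  horacle etheta0 ebeta0 stable.
by exists A, 1%N.
Qed.
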